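(* Suppose $C$ has full row rank, $(A,X_{11}^{1/2})$ is reachable, $V\in\mathbb{R}^{d\times d}$ is symmetric positive definite, $(A,B)$ is controllable, and $(C,A)$ and $(Q^{1/2},A)$ are observable. Then all minimal stationary points $\mathsf K^\star\in\mathbb{K}\cap\mathbb{K}_m\cap\mathbb{K}_s$ of the problem $\min_{\mathsf K\in\mathbb{K}}J(\mathsf K)$ with initial controller state $\xi_0=B_{\mathsf K}s$ are globally optimal (i.e. minimize $J$ over $\mathbb{K}$), and they are of the form $$\mathsf K^\star=\mathscr{T}_T(\mathsf K^\ddagger),\qquad \mathsf K^\ddagger:=\begin{bmatrix}0&-K^\star\\ L^\star&A-BK^\star-L^\star C\end{bmatrix},$$ where $T\in\mathrm{GL}_n$ is an arbitrary invertible matrix (that is, if minimal stationary points exist, they are exactly the controllers $\mathscr{T}_T(\mathsf K^\ddagger)$, $T\in\mathrm{GL}_n$). Here $$K^\star=(R+B^{\mathsf T}\hat PB)^{-1}B^{\mathsf T}\hat PA,$$ with $\hat P$ the unique positive definite solution of $\hat P=Q+A^{\mathsf T}\hat PA-A^{\mathsf T}\hat PB(R+B^{\mathsf T}\hat PB)^{-1}B^{\mathsf T}\hat PA$, and $$L^\star=A\hat\Sigma C^{\mathsf T}(C\hat\Sigma C^{\mathsf T}+V)^{-1},$$ with $\hat\Sigma$ the unique positive definite solution of $\hat\Sigma=X_{11}+A\hat\Sigma A^{\mathsf T}-A\hat\Sigma C^{\mathsf T}(C\hat\Sigma C^{\mathsf T}+V)^{-1}C\hat\Sigma A^{\mathsf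 T}$.
   Context: Fix $A\in\mathbb{R}^{n\times n}$, $B\in\mathbb{R}^{n\times m}$, $C\in\mathbb{R}^{d\times n}$, $Q\in\mathbb{R}^{n\times n}$ symmetric positive semidefinite and $R\in\mathbb{R}^{m\times m}$ symmetric positive definite. The system is $x_{t+1}=Ax_t+Bu_t$, $y_t=Cx_t$, controlled by the full-order dynamic controller $\xi_{t+1}=A_{\mathsf K}\xi_t+B_{\mathsf K}y_t$, $u_t=C_{\mathsf K}\xi_t$, with $\mathsf K=\begin{bmatrix}0_{m\times d}&C_{\mathsf K}\\ B_{\mathsf K}&A_{\mathsf K}\end{bmatrix}$, $A_{\mathsf K}\in\mathbb{R}^{n\times n}$, $B_{\mathsf K}\in\mathbb{R}^{n\times d}$, $C_{\mathsf K}\in\mathbb{R}^{m\times n}$. $\mathbb{K}$ is the set of such $\mathsf K$ for which the closed-loop matrix $\mathcal{A}_{\mathsf K}:=\begin{bmatrix}A&BC_{\mathsf K}\\ B_{\mathsf K}C&A_{\mathsf K}\end{bmatrix}$ has spectral radius less than $1$. $\mathbb{K}_m$ is the set of minimal controllers: those with $(C_{\mathsf K},A_{\mathsf K})$ observable and $(A_{\mathsf K},B_{\mathsf K})$ reachable. The cost is $J(\mathsf K)=\mathbb{E}\left[\sum_{t=0}^\infty(x_t^{\mathsf T}Qx_t+u_t^{\mathsf T}Ru_t)\right]=\mathrm{Tr}(P_{\mathsf K}X)$, where $P_{\mathsf K}$ is the unique positive semidefinite solution of $P_{\mathsf K}=\begin{bmatrix}Q&0\\ 0&C_{\mathsf K}^{\mathsf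 T}RC_{\mathsf K}\end{bmatrix}+\mathcal{A}_{\mathsf K}^{\mathsf T}P_{\mathsf K}\mathcal{A}_{\mathsf K}$, and $X$ is the second-moment matrix of $(x_0,\xi_0)$. The initial controller state is $\xi_0=B_{\mathsf K}s$, where $s\in\mathbb{R}^d$ is drawn from a fixed distribution $\mathcal{D}_s$ with zero mean and independent of $x_0$; hence $X=\begin{bmatrix}X_{11}&0\\ 0&B_{\mathsf K}VB_{\mathsf K}^{\mathsf T}\end{bmatrix}$ (depending on $\mathsf K$), with $X_{11}=\mathbb{E}[x_0x_0^{\mathsf T}]$ and $V=\mathbb{E}[ss^{\mathsf T}]$ fixed. $\mathbb{K}_s$ is the set of stationary points: controllers at which the gradients of this $J$ (taking into account the dependence of $X$ on $B_{\mathsf K}$) with respect to $A_{\mathsf K},B_{\mathsf K},C_{\mathsf K}$ all vanish. $\mathrm{GL}_n$ is the set of invertible real $n\times n$ matrices, and $\mathscr{T}_T(\mathsf K)=\begin{bmatrix}0&C_{\mathsf K}T^{-1}\\ TB_{\mathsf K}&TA_{\mathsf K}T^{-1}\end{bmatrix}$. *)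

(* Defs.v *)
From HB Require Import structures.
From mathcomp Require Import all_boot all_order all_algebra.
From mathcomp Require Import complex.
From mathcomp Require Import all_classical all_reals all_analysis.

Set Implicit Arguments.
Unset Strict Implicit.
Unset Printing Implicit Defensive.

Import Order.TTheory GRing.Theory Num.Theory.
Import numFieldNormedType.Exports.

Local Open Scope classical_set_scope.
Local Open Scope ring_scope.

Section LinearAlgebra.
Variable F : realType.

Definition quad_form n (M : 'M[F]_n) (v : 'cV[F]_n) : F :=
  (v^T *m M *m v) ord0 ord0.

Definition sym_psd n (M : 'M[F]_n) : Prop :=
  M^T = M /\ forall v : 'cV[F]_n, 0 <= quad_form M v.

Definition sym_pd n (M : 'M[F]_n) : Prop :=
  M^T = M /\ forall v : 'cV[F]_n, v != 0 -> 0 < quad_form M v.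

(* The square root is unique; [xget] only returns its default value 0 when
   [M] is not symmetric positive semidefinite. *)
Definition psd_sqrt n (M : 'M[F]_n) : 'M[F]_n :=
  xget 0 [set S : 'M[F]_n | sym_psd S /\ S *m S = M].

(* sup is 0 on the empty spectrum of a 0 x 0 matrix. *)
Definition spectral_radius n (M : 'M[F]_n) : F :=
  sup [set r : F | exists2 z : F[i],
    eigenvalue (map_mx (real_complex F) M) z & r = complex.Re `|z|].

Definition reachability_mx n p (A : 'M[F]_n) (B : 'M[F]_(n, p)) :=
  \mxrow_(k < n) (A ^+ k *m B).

Definition observability_mx n q (C : 'M[F]_(q, n)) (A : 'M[F]_n) :=
  \mxcol_(k < n) (C *m A ^+ k).

Definition reachable n p (A : 'M[F]_n) (B : 'M[F]_(n, p)) : Prop :=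
  \rank (reachability_mx A B) = n.

(* Controllability is understood in the sense of Kalman's rank condition, not
   as the weaker discrete-time notion of controllability to the origin. *)
Definition controllable n p (A : 'M[F]_n) (B : 'M[F]_(n, p)) : Prop :=
  reachable A B.

Definition observable n q (C : 'M[F]_(q, n)) (A : 'M[F]_n) : Prop :=
  \rank (observability_mx C A) = n.

Definition gradient p q (f : 'M[F]_(p, q) -> F^o) (X : 'M[F]_(p, q)) :
    'M[F]_(p, q) :=
  \matrix_(i < p, j < q) 'D_(delta_mx i j) f X.

(* Differentiability makes the directional derivatives genuine: ['D_v f X] is
   an arbitrary value when the limit does not exist. *)
Definition gradient_vanishes p q (f : 'M[F]_(p, q) -> F^o)
    (X : 'M[F]_(p, q)) : Prop :=
  differentiable f X /\ gradient f X = 0.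

End LinearAlgebra.

Section RandomVectors.
Context {dO : measure_display} {Omega : measurableType dO} {F : realType}.
Variable P : probability Omega F.

Definition rvec n (X : 'I_n -> {RV P >-> F}) (w : Omega) : 'cV[F]_n :=
  \col_i X i w.

Definition square_integrable n (X : 'I_n -> {RV P >-> F}) : Prop :=
  forall i, (X i : Omega -> F) \in Lfun P 2%:E.

Definition zero_mean n (X : 'I_n -> {RV P >-> F}) : Prop :=
  forall i, 'E_P[X i]%E = 0%E.

Definition second_moment n (X : 'I_n -> {RV P >-> F}) : 'M[F]_n :=
  \matrix_(i, j) fine 'E_P[(fun w => (X i w * X j w)%R)]%E.

Definition sigma_of n (X : 'I_n -> {RV P >-> F}) : set (set Omega) :=
  <<s [set E | exists i (U : set F), measurable U /\ E = X i @^-1` U] >>.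

Definition independent n p (X : 'I_n -> {RV P >-> F})
    (Y : 'I_p -> {RV P >-> F}) : Prop :=
  forall E G, sigma_of X E -> sigma_of Y G ->
    P (E `&` G) = (P E * P G)%E.

End RandomVectors.

(* A controller is the block matrix K = [0, CK; BK, AK]; the vanishing of the
   upper left block is part of membership in [stabilizing]. *)
Section Controllers.
Variables (F : realType) (n m d : nat).
Implicit Types K : 'M[F]_(m + n, d + n).

Definition ctrl_mx (AK : 'M[F]_n) (BK : 'M[F]_(n, d)) (CK : 'M[F]_(m, n)) :
    'M[F]_(m + n, d + n) :=
  block_mx 0 CK BK AK.

Definition ctrlA K : 'M[F]_n := drsubmx K.
Definition ctrlB K : 'M[F]_(n, d) := dlsubmx K.
Definition ctrlC K : 'M[F]_(m, n) := ursubmx K.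

Definition minimal : set 'M[F]_(m + n, d + n) :=
  [set K | observable (ctrlC K) (ctrlA K) /\ reachable (ctrlA K) (ctrlB K)].

Definition sim_transform (T : 'M[F]_n) K : 'M[F]_(m + n, d + n) :=
  ctrl_mx (T *m ctrlA K *m invmx T) (T *m ctrlB K) (ctrlC K *m invmx T).

Variables (A : 'M[F]_n) (B : 'M[F]_(n, m)) (C : 'M[F]_(d, n)).

Definition closed_loop_mx K : 'M[F]_(n + n) :=
  block_mx A (B *m ctrlC K) (ctrlB K *m C) (ctrlA K).

Definition stabilizing : set 'M[F]_(m + n, d + n) :=
  [set K | ulsubmx K = 0 /\ spectral_radius (closed_loop_mx K) < 1].

(* The pair (x_t, xi_t) started from x_0 and xi_0 = BK s. *)
Fixpoint trajectory K (x0 : 'cV[F]_n) (s : 'cV[F]_d) (t : nat) :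
    'cV[F]_n * 'cV[F]_n :=
  if t is t'.+1 then
    let: (x, xi) := trajectory K x0 s t' in
    let u := ctrlC K *m xi in
    let y := C *m x in
    (A *m x + B *m u, ctrlA K *m xi + ctrlB K *m y)
  else (x0, ctrlB K *m s).

Variables (Q : 'M[F]_n) (R : 'M[F]_m).

Definition stage_cost K (x0 : 'cV[F]_n) (s : 'cV[F]_d) (t : nat) : F :=
  let: (x, xi) := trajectory K x0 s t in
  quad_form Q x + quad_form R (ctrlC K *m xi).

Context {dO : measure_display} {Omega : measurableType dO}.
Variable P : probability Omega F.
Variables (x0 : 'I_n -> {RV P >-> F}) (s : 'I_d -> {RV P >-> F}).

Definition cost K : \bar F :=
  (\int[P]_w \sum_(0 <= t <oo) (stage_cost K (rvec x0 w) (rvec s w) t)%:E)%E.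

(* Meaningful on [stabilizing] only, where [cost] is finite and [fine] loses
   nothing. *)
Definition stationary : set 'M[F]_(m + n, d + n) :=
  [set K | [/\
    gradient_vanishes
      (fun AK => fine (cost (ctrl_mx AK (ctrlB K) (ctrlC K)))) (ctrlA K),
    gradient_vanishes
      (fun BK => fine (cost (ctrl_mx (ctrlA K) BK (ctrlC K)))) (ctrlB K) &
    gradient_vanishes
      (fun CK => fine (cost (ctrl_mx (ctrlA K) (ctrlB K) CK))) (ctrlC K)]].

Definition globally_optimal K : Prop :=
  stabilizing K /\
  forall K', stabilizing K' -> (cost K <= cost K')%E.

End Controllers.

Section Riccati.
Variables (F : realType) (n m d : nat).
Variables (A : 'M[F]_n) (B : 'M[F]_(n, m)) (C : 'M[F]_(d, n)).
Variables (Q X11 : 'M[F]_n) (R : 'M[F]_m) (V : 'M[F]_d).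
Implicit Types P S : 'M[F]_n.

Definition pd_ctrl_riccati P : Prop :=
  sym_pd P /\
  P = Q + A^T *m P *m A
    - A^T *m P *m B *m invmx (R + B^T *m P *m B) *m B^T *m P *m A.

Definition pd_filter_riccati S : Prop :=
  sym_pd S /\
  S = X11 + A *m S *m A^T
    - A *m S *m C^T *m invmx (C *m S *m C^T + V) *m C *m S *m A^T.

Definition ctrl_gain P : 'M[F]_(m, n) :=
  invmx (R + B^T *m P *m B) *m B^T *m P *m A.

Definition filter_gain S : 'M[F]_(n, d) :=
  A *m S *m C^T *m invmx (C *m S *m C^T + V).

Definition observer_ctrl (Kg : 'M[F]_(m, n)) (L : 'M[F]_(n, d)) :
    'M[F]_(m + n, d + n) :=
  ctrl_mx (A - B *m Kg - L *m C) L (- Kg).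

End Riccati.

(* Main.v *)
Require Import Defs.
From HB Require Import structures.
From mathcomp Require Import all_boot all_order all_algebra.
From mathcomp Require Import ring lra.
From mathcomp Require Import complex.
From mathcomp Require Import all_classical all_reals all_analysis.
From mathcomp Require Import measurable_realfun.
Import Order.TTheory GRing.Theory Num.Theory.
Import numFieldNormedType.Exports.
Local Open Scope classical_set_scope.
Local Open Scope ring_scope.
Set Implicit Arguments.
Unset Strict Implicit.
Unset Printing Implicit Defensive.

(** The cost of a stabilizing controller depends only on second moments.  With
    closed-loop matrix [M], source [X] (the second moment of the initial state)
    and weight [W], let [S] solve [S = X + M S M^T] and let [P] solve
    [P = W + M^T P M]; the cost is [tr (W S) = tr (P X)].  Since the controller
    starts at [BK s], the corner of [X] is [BK V BK^T]: the cost is that of the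
    stationary LQG problem with process noise [X11] and measurement noise [V].

    Stationarity.  The derivative of the cost along a change [E] of [M] pairs [E]
    with [2 P M S], and the changes of [W] and [X] add their own linear terms; at
    a stationary point this yields three block equations in [P M S]
    ([lyapunov_perturbation], [stationary_equations]).
    Minimality of the controller makes the corners [P22] and [S22] positive
    definite ([controller_gramian_pd]), hence [T = - P22^-1 P21] and
    [G = S12 S22^-1] make sense.  Reading the block equations together with the
    Lyapunov equation of [S] gives [S22 = T S12], that is [T G = 1]; then the
    Schur complements of [P22] in [P] and of [S22] in [S] solve the two Riccati
    equations, and the controller is the observer-based controller with the
    corresponding gains, transported by [T] ([stationary_structure]).

    Riccati equations.  Completing the square in the control
    ([riccati_square]) shows that the Riccati map is monotone, so value iteration
    from 0 increases, and controllability bounds it by the cost of steering to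
    the origin; the limit is a solution.  Observability makes every positive
    semidefinite solution positive definite with a stable closed loop, and the
    difference of two solutions is then forced to vanish.  The filter equation is
    the control equation of the transposed data.

    Optimality.  Let [Ph] and [Sh] solve the Riccati equations, with gain [K] and
    weight [Rt = R + B^T Ph B].  Completing the square again writes the cost of
    any stabilizing controller as [tr (Ph X11)] plus the [Rt]-weighted covariance
    of [u + K x] ([cost_square]).  The covariance [S] of any controller dominates
    that of the estimation error, namely [Sh] in the plant corner, because their
    difference solves a Lyapunov equation with positive semidefinite source
    ([covariance_excess_psd]).  This gives a lower bound which a minimal
    stationary point attains.

    Finally, a change of controller coordinates preserves stability, minimality,
    cost and stationarity, so one minimal stationary point yields its whole
    similarity orbit. *)

(** * Entries and noncommutative matrix identities *)

Section MatrixEntries.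
Variable K : pzRingType.

Lemma mx_entryD p q (M N : 'M[K]_(p, q)) i j : (M + N) i j = M i j + N i j.
Proof. by rewrite mxE. Qed.
Lemma mx_entryN p q (M : 'M[K]_(p, q)) i j : (- M) i j = - M i j.
Proof. by rewrite mxE. Qed.
Lemma mx_entryZ p q a (M : 'M[K]_(p, q)) i j : (a *: M) i j = a * M i j.
Proof. by rewrite mxE. Qed.
Lemma mx_entry0 p q i j : (0 : 'M[K]_(p, q)) i j = 0.
Proof. by rewrite mxE. Qed.
End MatrixEntries.

Definition mx_entryE := (mx_entryD, mx_entryN, mx_entryZ, mx_entry0).

Section MatrixTactics.
Variable F : realType.
Lemma trmxDE p q (M N : 'M[F]_(p, q)) : (M + N)^T = M^T + N^T.
Proof. exact: linearD. Qed.
Lemma trmxNE p q (M : 'M[F]_(p, q)) : (- M)^T = - M^T.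
Proof. exact: linearN. Qed.
Lemma trmxZE p q a (M : 'M[F]_(p, q)) : (a *: M)^T = a *: M^T.
Proof. exact: linearZ. Qed.
Lemma mxtraceBE n (Y Z : 'M[F]_n) : \tr (Y - Z) = \tr Y - \tr Z.
Proof. exact: linearB. Qed.
End MatrixTactics.

(** Local definitions are cleared first: rewriting would try to unfold them to
    expose sums and units. *)
Ltac mx_expand := repeat match goal with H := _ |- _ => clearbody H end;
  rewrite ?(trmxDE, trmxNE, trmxZE, trmx_mul, trmxK, trmx1, trmx0)
  ?(mulmxDl, mulmxDr, mulNmx, mulmxN, mulmx1, mul1mx, mulmx0, mul0mx) ?mulmxA.

(** The products are made abstract before [ring] runs, which otherwise compares
    distinct monomials by unfolding them. *)
Ltac mx_abel := apply/matrixP => ? ?; rewrite ?mx_entryE;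
  generalize (@mulmx); intro; generalize (@trmx); intro; ring.

(** * Quadratic forms and positive semidefinite matrices *)

Section QuadraticForms.
Variable F : realType.

Lemma quad_formD n (M N : 'M[F]_n) v :
  quad_form (M + N) v = quad_form M v + quad_form N v.
Proof. by rewrite /quad_form mulmxDr mulmxDl mx_entryE. Qed.

Lemma quad_formN n (M : 'M[F]_n) v : quad_form (- M) v = - quad_form M v.
Proof. by rewrite /quad_form mulmxN mulNmx mx_entryE. Qed.

Lemma quad_formB n (M N : 'M[F]_n) v :
  quad_form (M - N) v = quad_form M v - quad_form N v.
Proof. by rewrite quad_formD quad_formN. Qed.

Lemma quad_formZ n a (M : 'M[F]_n) v : quad_form (a *: M) v = a * quad_form M v.
Proof. by rewrite /quad_form -scalemxAr -scalemxAl mx_entryE. Qed.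

Lemma quad_form0 n (v : 'cV[F]_n) : quad_form 0 v = 0.
Proof. by rewrite /quad_form mulmx0 mul0mx mxE. Qed.

Lemma quad_form_sum n I (r : seq I) (P : pred I) (f : I -> 'M[F]_n) v :
  quad_form (\sum_(i <- r | P i) f i) v = \sum_(i <- r | P i) quad_form (f i) v.
Proof.
by apply: (big_morph (fun M : 'M[F]_n => quad_form M v)) => [M N|];
  rewrite ?quad_formD ?quad_form0.
Qed.

Lemma quad_formv0 n (M : 'M[F]_n) : quad_form M 0 = 0.
Proof. by rewrite /quad_form mulmx0 mxE. Qed.

Lemma quad_form_congr n p (M : 'M[F]_n) (G : 'M[F]_(n, p)) v :
  quad_form (G^T *m M *m G) v = quad_form M (G *m v).
Proof. by rewrite /quad_form trmx_mul !mulmxA. Qed.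

Lemma quad_form_congrV n p (M : 'M[F]_n) (G : 'M[F]_(p, n)) v :
  quad_form (G *m M *m G^T) v = quad_form M (G^T *m v).
Proof. by rewrite -quad_form_congr trmxK. Qed.

Lemma quad_form_tr n (M : 'M[F]_n) v : quad_form M v = \tr (M *m (v *m v^T)).
Proof. by rewrite mulmxA mxtrace_mulC mulmxA trace_mx11. Qed.

Lemma quad_form_vD n (M : 'M[F]_n) (u v : 'cV[F]_n) :
  quad_form M (u + v) = quad_form M u + (u^T *m M *m v) ord0 ord0
    + (v^T *m M *m u) ord0 ord0 + quad_form M v.
Proof.
rewrite /quad_form [(u + v)^T]linearD /= !mulmxDl !mulmxDr !mx_entryE.
by rewrite !addrA.
Qed.

Lemma quad_form_vZ n (M : 'M[F]_n) a (v : 'cV[F]_n) :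
  quad_form M (a *: v) = a ^+ 2 * quad_form M v.
Proof.
by rewrite /quad_form [(a *: v)^T]linearZ /= -!scalemxAl -!scalemxAr !mx_entryE expr2 mulrA.
Qed.

Lemma bilin_sym n (M : 'M[F]_n) (u v : 'cV[F]_n) : M^T = M ->
  (v^T *m M *m u) ord0 ord0 = (u^T *m M *m v) ord0 ord0.
Proof.
by move=> sM; rewrite -[in LHS]trace_mx11 -mxtrace_tr !trmx_mul trmxK sM
  mulmxA trace_mx11.
Qed.

Lemma quad_form_block n p (A : 'M[F]_n) (B : 'M[F]_(n, p)) C D u v :
  quad_form (block_mx A B C D) (col_mx u v) =
  quad_form A u + (u^T *m B *m v) ord0 ord0
  + (v^T *m C *m u) ord0 ord0 + quad_form D v.
Proof.
rewrite /quad_form tr_col_mx mul_row_block mul_row_col !mulmxDl !mx_entryE.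
by rewrite !addrA; congr (_ + _); rewrite addrAC.
Qed.

Lemma sqnorm_sum n (v : 'cV[F]_n) : quad_form 1%:M v = \sum_i v i ord0 ^+ 2.
Proof.
by rewrite /quad_form mulmx1 mxE; apply: eq_bigr => i _; rewrite mxE expr2.
Qed.

Lemma sqnorm_ge0 n (v : 'cV[F]_n) : 0 <= quad_form 1%:M v.
Proof. by rewrite sqnorm_sum; apply: sumr_ge0 => i _; apply: sqr_ge0. Qed.

Lemma sqnorm_entry n (v : 'cV[F]_n) i : v i ord0 ^+ 2 <= quad_form 1%:M v.
Proof.
rewrite sqnorm_sum (bigD1 i) //= lerDl; apply: sumr_ge0 => j _.
exact: sqr_ge0.
Qed.

Lemma sqnorm_eq0 n (v : 'cV[F]_n) : quad_form 1%:M v = 0 -> v = 0.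
Proof.
move=> v0; apply/matrixP => i j; rewrite !mxE (ord1 j).
apply/eqP; rewrite -sqrf_eq0 eq_le sqr_ge0 andbT -v0.
exact: sqnorm_entry.
Qed.

Lemma sqnorm_gt0 n (v : 'cV[F]_n) : v != 0 -> 0 < quad_form 1%:M v.
Proof.
move=> v0; rewrite lt_neqAle sqnorm_ge0 andbT eq_sym.
by apply: contra_neq v0 => /sqnorm_eq0.
Qed.

Lemma sym_pd_psd n (M : 'M[F]_n) : sym_pd M -> sym_psd M.
Proof.
case=> sM pM; split=> // v; have [->|/pM/ltW//] := eqVneq v 0.
by rewrite quad_formv0.
Qed.

Lemma sym_psd0 n : sym_psd (0 : 'M[F]_n).
Proof. by split=> [|v]; rewrite ?trmx0 ?quad_form0. Qed.

Lemma sym_pd1 n : sym_pd (1%:M : 'M[F]_n).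
Proof. by split=> [|v]; [rewrite trmx1|exact: sqnorm_gt0]. Qed.

Lemma sym_psdD n (M N : 'M[F]_n) : sym_psd M -> sym_psd N -> sym_psd (M + N).
Proof.
move=> [sM pM] [sN pN]; split=> [|v]; first by rewrite linearD /= sM sN.
by rewrite quad_formD addr_ge0.
Qed.

Lemma sym_psd_sum n I (r : seq I) (P : pred I) (f : I -> 'M[F]_n) :
  (forall i, P i -> sym_psd (f i)) -> sym_psd (\sum_(i <- r | P i) f i).
Proof.
by move=> pf; apply: big_ind => //; [exact: sym_psd0|exact: sym_psdD].
Qed.

Lemma sym_psd_congr n p (M : 'M[F]_n) (G : 'M[F]_(n, p)) :
  sym_psd M -> sym_psd (G^T *m M *m G).
Proof.
move=> [sM pM]; split=> [|v]; first by rewrite !trmx_mul trmxK sM mulmxA.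
by rewrite quad_form_congr.
Qed.

Lemma sym_psd_congrV n p (M : 'M[F]_n) (G : 'M[F]_(p, n)) :
  sym_psd M -> sym_psd (G *m M *m G^T).
Proof. by move=> /(sym_psd_congr G^T); rewrite trmxK. Qed.

Lemma sym_pdD n (M N : 'M[F]_n) : sym_pd M -> sym_psd N -> sym_pd (M + N).
Proof.
move=> [sM pM] [sN pN]; split=> [|v v0]; first by rewrite linearD /= sM sN.
by rewrite quad_formD ltr_wpDr // pM.
Qed.

Lemma sym_psd_pd n (M : 'M[F]_n) :
  sym_psd M -> (forall v, quad_form M v = 0 -> v = 0) -> sym_pd M.
Proof.
move=> [sM pM] dM; split=> // v v0; rewrite lt_neqAle pM andbT eq_sym.
by apply: contra_neq v0 => /dM.
Qed.

(** Moving from a zero [v] of the form in a direction [w] changes the value by a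
    term linear in the step, which must vanish for the form to stay
    nonnegative. *)
Lemma sym_psd_ker n (M : 'M[F]_n) v :
  sym_psd M -> quad_form M v = 0 -> M *m v = 0.
Proof.
move=> [sM pM] v0; apply/matrixP => i j; rewrite (ord1 j) mx_entryE.
set w : 'cV[F]_n := delta_mx i ord0.
have -> : (M *m v) i ord0 = (w^T *m M *m v) ord0 ord0.
  by rewrite -mulmxA trmx_delta -rowE [RHS]mxE.
set b := _ ord0 ord0; have [//|b0] := eqVneq b 0.
(* This step is chosen so that the form takes the value -1. *)
have := pM (w + (- (quad_form M w + 1) / (2 * b)) *: v).
rewrite quad_form_vD quad_form_vZ v0 mulr0 addr0 -scalemxAr.
rewrite linearZ /= -!scalemxAl !mx_entryE (bilin_sym w v sM) -/b.
have -> : quad_form M w + - (quad_form M w + 1) / (2 * b) * b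
  + - (quad_form M w + 1) / (2 * b) * b = -1 by field.
by rewrite ler0N1.
Qed.

Lemma sym_pd_unit n (M : 'M[F]_n) : sym_pd M -> M \in unitmx.
Proof.
move=> [sM pM]; rewrite -row_free_unit.
apply/inj_row_free => v vM; apply/eqP; apply/negPn/negP => v0.
have /pM : v^T != 0 by rewrite trmx_eq0.
by rewrite /quad_form trmxK vM mul0mx mxE ltxx.
Qed.

Lemma gram_block n p (r : 'M[F]_n) (b : 'M[F]_(n, p)) (G : 'M[F]_p) :
  (block_mx r b 0 G)^T *m block_mx r b 0 G =
  block_mx (r^T *m r) (r^T *m b) (b^T *m r) (b^T *m b + G^T *m G).
Proof.
by rewrite tr_block_mx mulmx_block trmx0 !mulmx0 !mul0mx !addr0.
Qed.

(** Cholesky factorization, by induction on the dimension.  If the corner entry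
    [a] is positive, the Schur complement of [a] is positive semidefinite; if it
    is zero, so is the first row, by [sym_psd_ker]. *)
Lemma sym_psd_factor n (M : 'M[F]_n) :
  sym_psd M -> exists G : 'M[F]_n, M = G^T *m G.
Proof.
elim: n M => [|n IHn] M psdM.
  by exists 0; rewrite [LHS]flatmx0 [RHS]flatmx0.
pose N : 'M[F]_(1 + n) := M.
have [sM pM] : sym_psd N := psdM.
have defM : N = block_mx (N ord0 ord0)%:M (ursubmx N) (ursubmx N)^T (drsubmx N).
  rewrite -[LHS]submxK -[in LHS]sM !trmx_ursub sM.
  congr block_mx; apply/matrixP => i j; rewrite !mxE !ord1 eqxx mulr1n.
  by congr (N _ _); apply/val_inj.
move: defM; set a := N _ _; set b := ursubmx N; set D := drsubmx N => defM.
have pMb x v : 0 <= a * x ^+ 2 + 2 * x * (b *m v) ord0 ord0 + quad_form D v.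
  have := pM (col_mx x%:M v); rewrite {1}defM quad_form_block.
  rewrite tr_scalar_mx -!mulmxA !mul_scalar_mx mx_entryE.
  rewrite [quad_form a%:M _]/quad_form tr_scalar_mx -!scalar_mxM.
  rewrite mxE eqxx mulr1n mulmxA -trmx_mul mul_mx_scalar mx_entryE.
  rewrite [_^T _ _]mxE.
  suff -> : x * a * x + x * (b *m v) ord0 ord0 + x * (b *m v) ord0 ord0 =
    a * x ^+ 2 + 2 * x * (b *m v) ord0 ord0 by [].
  by ring.
have sD : D^T = D by rewrite /D trmx_drsub sM.
have a_ge0 : 0 <= a.
  by have := pMb 1 0; rewrite mulmx0 quad_formv0 mxE !mulr0 !addr0 expr1n mulr1.
have [a0|an0] := eqVneq a 0.
  have b0 : b = 0.
    have : N *m col_mx 1%:M 0 = 0.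
      apply: sym_psd_ker => //; rewrite defM quad_form_block a0.
      rewrite !mulmx0 quad_formv0 trmx0 !mul0mx !mxE !addr0.
      by rewrite /quad_form raddf0 mulmx0 mul0mx mxE.
    rewrite defM mul_block_col !mulmx0 !addr0 !mulmx1.
    rewrite -[RHS]col_mx0 => /eq_col_mx[_ /(congr1 trmx)].
    by rewrite trmxK trmx0.
  have /IHn[G defD] : sym_psd D.
    split=> // v; have := pMb 0 v.
    by rewrite a0 !mulr0 !mul0r !add0r.
  exists (block_mx 0 0 0 G : 'M[F]_(1 + n)).
  rewrite -[LHS]/N defM a0 b0 [in LHS]defD.
  apply: etrans (esym (gram_block (0 : 'M[F]_1) 0 G)).
  by rewrite !trmx0 !mul0mx !add0r raddf0.
have a_gt0 : 0 < a by rewrite lt_neqAle eq_sym an0.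
have /IHn[G defD] : sym_psd (D - a^-1 *: (b^T *m b)).
  split=> [|v]; first by rewrite linearB linearZ /= trmx_mul trmxK sD.
  (* The minimum of the form over the first coordinate is the Schur complement. *)
  have := pMb (- a^-1 * (b *m v) ord0 ord0) v.
  rewrite quad_formB quad_formZ -[b^T]mulmx1 quad_form_congr sqnorm_sum big_ord1.
  set y := (b *m v) _ _.
  suff -> : a * (- a^-1 * y) ^+ 2 + 2 * (- a^-1 * y) * y = - (a^-1 * y ^+ 2).
    by rewrite addrC.
  by field.
exists (block_mx (Num.sqrt a)%:M ((Num.sqrt a)^-1 *: b) 0 G : 'M[F]_(1 + n)).
rewrite -[LHS]/N defM.
apply: etrans (esym (gram_block (Num.sqrt a)%:M ((Num.sqrt a)^-1 *: b) G)).
have sa0 : Num.sqrt a != 0 by rewrite gt_eqF ?sqrtr_gt0.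
rewrite tr_scalar_mx -defD; congr block_mx.
- by rewrite -scalar_mxM -expr2 sqr_sqrtr.
- by rewrite -scalemxAr mul_scalar_mx scalerA mulVf // scale1r.
- by rewrite linearZ /= -scalemxAl mul_mx_scalar scalerA mulVf // scale1r.
- rewrite [(_ *: b)^T]linearZ /= -scalemxAl -scalemxAr scalerA
    -invfM -expr2 sqr_sqrtr //.
  by rewrite addrC subrK.
Qed.

(** For [Y = G^T *m G] the trace is the sum of the values of [M] at the rows of
    [G]. *)
Lemma psd_trace_ge0 n (M Y : 'M[F]_n) :
  (forall v, 0 <= quad_form M v) -> sym_psd Y -> 0 <= \tr (M *m Y).
Proof.
move=> pM /sym_psd_factor[G ->]; rewrite mulmxA mxtrace_mulC mulmxA.
apply: sumr_ge0 => i _; have := pM (row i G)^T.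
rewrite /quad_form trmxK -row_mul tr_row !mxE.
by congr (_ <= _); apply: eq_bigr => j _; rewrite !mxE.
Qed.

Lemma quad_form_entries n (Z : 'M[F]_n) (v : 'cV[F]_n) :
  quad_form Z v = \sum_i \sum_j Z i j * (v i ord0 * v j ord0).
Proof.
rewrite /quad_form -mulmxA mxE; apply: eq_bigr => i _.
rewrite !mxE mulr_sumr; apply: eq_bigr => j _; ring.
Qed.

Lemma quad_form_bound n (Z : 'M[F]_n) :
  exists2 c, 0 <= c & forall v, `|quad_form Z v| <= c * quad_form 1%:M v.
Proof.
exists (\sum_i \sum_j `|Z i j|) => [|v].
  by apply: sumr_ge0 => i _; apply: sumr_ge0.
rewrite quad_form_entries mulr_suml (le_trans (ler_norm_sum _ _ _)) //; apply: ler_sum => i _.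
rewrite mulr_suml (le_trans (ler_norm_sum _ _ _)) //; apply: ler_sum => j _.
rewrite normrM ler_wpM2l // normrM.
have := sqnorm_entry v i; have := sqnorm_entry v j.
rewrite -[v i _ ^+ 2]ger0_norm ?sqr_ge0 // -[v j _ ^+ 2]ger0_norm ?sqr_ge0 //.
rewrite !normrX.
set x := `|v i _|; set y := `|v j _|; set q := quad_form _ _ => hx hy.
have := sqr_ge0 (x - y); nra.
Qed.

(** The trace plays the role of a norm on positive semidefinite matrices. *)
Lemma trace_bound n (Z : 'M[F]_n) :
  exists2 c, 0 <= c & forall Y, sym_psd Y -> `|\tr (Z *m Y)| <= c * \tr Y.
Proof.
have [c c0 cZ] := quad_form_bound Z; exists c => // Y pY.
have hp : 0 <= \tr ((c *: 1%:M - Z) *m Y).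
  apply: psd_trace_ge0 => // v; rewrite quad_formB quad_formZ subr_ge0.
  exact: le_trans (ler_norm _) (cZ v).
have hm : 0 <= \tr ((c *: 1%:M + Z) *m Y).
  apply: psd_trace_ge0 => // v; rewrite quad_formD quad_formZ.
  by rewrite -[X in _ + X]opprK subr_ge0 (le_trans _ (cZ v)) // ler_normr lexx orbT.
move: hp hm; rewrite mulmxBl mulmxDl -scalemxAl mul1mx linearB linearD linearZ /=.
by rewrite ler_norml => ? ?; apply/andP; split; lra.
Qed.

(** Writing [W = G^T *m G] with [G] invertible, [v] is recovered from [G *m v],
    whose square norm is the value of [W] at [v]. *)
Lemma sym_pd_coercive n (W : 'M[F]_n) : sym_pd W ->
  exists2 c, 0 <= c & forall v, quad_form 1%:M v <= c * quad_form W v.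
Proof.
move=> pW; have uW := sym_pd_unit pW.
have [G defW] := sym_psd_factor (sym_pd_psd pW).
have uG : G \in unitmx by move: uW; rewrite defW unitmx_mul => /andP[].
have [c c0 cP] := quad_form_bound ((invmx G)^T *m 1%:M *m invmx G).
exists c => // v; have := cP (G *m v); rewrite quad_form_congr mulKmx //.
rewrite -[quad_form 1%:M (G *m v)]quad_form_congr mulmx1 -defW.
exact/le_trans/ler_norm.
Qed.

End QuadraticForms.

(** * Entrywise convergence of matrices *)

Section MatrixConvergence.
Variable F : realType.

Definition mcvg p q (u : nat -> 'M[F]_(p, q)) (L : 'M[F]_(p, q)) :=
  forall i j, u k i j @[k --> \oo] --> L i j.

Lemma cvg_sumr I (r : seq I) (P : pred I) (u : I -> nat -> F) (l : I -> F) :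
  (forall i, P i -> u i k @[k --> \oo] --> l i) ->
  \sum_(i <- r | P i) u i k @[k --> \oo] --> \sum_(i <- r | P i) l i.
Proof. by move=> ul; apply: cvg_big => //; apply: add_continuous. Qed.

Lemma cvg_prodr I (r : seq I) (P : pred I) (u : I -> nat -> F) (l : I -> F) :
  (forall i, P i -> u i k @[k --> \oo] --> l i) ->
  \prod_(i <- r | P i) u i k @[k --> \oo] --> \prod_(i <- r | P i) l i.
Proof. by move=> ul; apply: cvg_big => //; apply: mul_continuous. Qed.

Lemma mcvg_cst p q (L : 'M[F]_(p, q)) : mcvg (fun=> L) L.
Proof. by move=> i j; apply: cvg_cst. Qed.

Lemma mcvg_eq p q (u v : nat -> 'M[F]_(p, q)) L : u =1 v -> mcvg u L -> mcvg v L.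
Proof. by move=> /funext ->. Qed.

Lemma mcvgD p q (u v : nat -> 'M[F]_(p, q)) L M :
  mcvg u L -> mcvg v M -> mcvg (fun k => u k + v k) (L + M).
Proof.
move=> uL vM i j; rewrite mxE; under eq_fun do rewrite mxE.
by apply: cvgD; [apply: uL|apply: vM].
Qed.

Lemma mcvgN p q (u : nat -> 'M[F]_(p, q)) L :
  mcvg u L -> mcvg (fun k => - u k) (- L).
Proof.
by move=> uL i j; rewrite mxE; under eq_fun do rewrite mxE; apply: cvgN; apply: uL.
Qed.

Lemma mcvg_tr p q (u : nat -> 'M[F]_(p, q)) L :
  mcvg u L -> mcvg (fun k => (u k)^T) L^T.
Proof. by move=> uL i j; rewrite mxE; under eq_fun do rewrite mxE; apply: uL. Qed.

Lemma mcvgM p q r (u : nat -> 'M[F]_(p, q)) (v : nat -> 'M[F]_(q, r)) L M :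
  mcvg u L -> mcvg v M -> mcvg (fun k => u k *m v k) (L *m M).
Proof.
move=> uL vM i j; rewrite mxE; under eq_fun do rewrite mxE.
by apply: cvg_sumr => l _; apply: cvgM; [apply: uL|apply: vM].
Qed.

Lemma mcvg_unique p q (u : nat -> 'M[F]_(p, q)) L M :
  mcvg u L -> mcvg u M -> L = M.
Proof. by move=> uL uM; apply/matrixP => i j; apply: cvg_unique (uL i j) (uM i j). Qed.

Lemma mcvg_det n (u : nat -> 'M[F]_n) L :
  mcvg u L -> \det (u k) @[k --> \oo] --> \det L.
Proof.
move=> uL; rewrite /determinant; apply: cvg_sumr => s _.
by apply: cvgMr; apply: cvg_prodr => i _; apply: uL.
Qed.

Lemma mcvg_adj n (u : nat -> 'M[F]_n) L :
  mcvg u L -> mcvg (fun k => \adj (u k)) (\adj L).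
Proof.
move=> uL i j; rewrite mxE; under eq_fun do rewrite mxE.
rewrite /cofactor; apply: cvgMr; apply: mcvg_det => k l.
by rewrite !mxE; under eq_fun do rewrite !mxE; apply: uL.
Qed.

Lemma mcvg_inv n (u : nat -> 'M[F]_n) L :
  (forall k, u k \in unitmx) -> L \in unitmx ->
  mcvg u L -> mcvg (fun k => invmx (u k)) (invmx L).
Proof.
move=> unitu unitL uL i j; rewrite /invmx unitL mx_entryE.
under eq_fun do rewrite unitu mx_entryE.
apply: cvgM; last exact: mcvg_adj.
apply: cvgV; last exact: mcvg_det.
by rewrite -unitfE -unitmxE.
Qed.

Lemma mcvg_quad n (u : nat -> 'M[F]_n) L v :
  mcvg u L -> quad_form (u k) v @[k --> \oo] --> quad_form L v.
Proof.
move=> uL; rewrite /quad_form.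
have := mcvgM (mcvgM (@mcvg_cst _ _ v^T) uL) (@mcvg_cst _ _ v); exact.
Qed.

Lemma mcvg_quadv n (M : 'M[F]_n) (u : nat -> 'cV[F]_n) v :
  mcvg u v -> quad_form M (u k) @[k --> \oo] --> quad_form M v.
Proof.
move=> uv.
have := mcvgM (mcvgM (mcvg_tr uv) (@mcvg_cst _ _ M)) uv; exact.
Qed.

Lemma cvg_mxtrace n (u : nat -> 'M[F]_n) L :
  mcvg u L -> \tr (u k) @[k --> \oo] --> \tr L.
Proof. by move=> uL; apply: cvg_sumr => i _; apply: uL. Qed.

End MatrixConvergence.

(** * Lyapunov equations *)

Section Lyapunov.
Variable F : realType.

Definition power_stable n (M : 'M[F]_n) := mcvg (fun k => M ^+ k) 0.

Lemma trmxX n (M : 'M[F]_n) k : (M ^+ k)^T = M^T ^+ k.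
Proof.
elim: k => [|k IHk]; first by rewrite !expr0 trmx1.
by rewrite exprS exprSr -IHk -[LHS]/(M *m M ^+ k)^T trmx_mul.
Qed.

Lemma mulmxXS n (M : 'M[F]_n) k : M ^+ k.+1 = M *m M ^+ k.
Proof. by rewrite exprS. Qed.
Lemma mulmxXSr n (M : 'M[F]_n) k : M ^+ k.+1 = M ^+ k *m M.
Proof. by rewrite exprSr. Qed.

Lemma power_stable_tr n (M : 'M[F]_n) : power_stable M -> power_stable M^T.
Proof.
move=> /mcvg_tr; rewrite trmx0; apply: mcvg_eq => k; exact: trmxX.
Qed.

Lemma power_stable_quad n (M Y : 'M[F]_n) v : power_stable M ->
  quad_form Y (M ^+ k *m v) @[k --> \oo] --> (0 : F).
Proof.
move=> sM; rewrite -[0 in X in _ --> X](quad_formv0 Y); apply: mcvg_quadv.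
by rewrite -[0](mul0mx _ v); apply: mcvgM => //; apply: mcvg_cst.
Qed.

(** Iterating the equation gives [Y = M ^+ k *m Y *m N ^+ k] for every [k]. *)
Lemma stein_eq0 n (M N Y : 'M[F]_n) :
  power_stable M -> power_stable N -> Y = M *m Y *m N -> Y = 0.
Proof.
move=> sM sN YE.
have Yk k : Y = M ^+ k *m Y *m N ^+ k.
  elim: k => [|k IHk]; first by rewrite !expr0 mul1mx mulmx1.
  by rewrite {1}IHk {1}YE mulmxXSr mulmxXS !mulmxA.
apply: (@mcvg_unique _ _ _ (fun=> Y)); first exact: mcvg_cst.
rewrite -[0](mulmx0 _ (0 *m Y)).
apply: (@mcvg_eq _ _ _ (fun k => M ^+ k *m Y *m N ^+ k)); first by move=> k.
by apply: mcvgM => //; apply: mcvgM => //; apply: mcvg_cst.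
Qed.

(** The map [Y |-> Y - M *m Y *m M^T] is injective by [stein_eq0], hence onto
    since it is an endomorphism of a space of finite dimension. *)
Lemma lyapunov_exists n (M X : 'M[F]_n) : power_stable M ->
  exists S, S = X + M *m S *m M^T.
Proof.
move=> sM; pose L := 1%:M - lin_mulmx M *m lin_mulmxr M^T.
have LE Y : mxvec Y *m L = mxvec (Y - M *m Y *m M^T).
  by rewrite mulmxBr mulmx1 mulmxA !mul_vec_lin /= linearB.
have uL : L \in unitmx.
  rewrite -row_free_unit; apply/inj_row_free => v.
  rewrite -[v]vec_mxK LE => /(congr1 vec_mx); rewrite mxvecK linear0 => /subr0_eq.
  by move=> /(stein_eq0 sM (power_stable_tr sM)) ->; rewrite linear0.
exists (vec_mx (mxvec X *m invmx L)); set S := vec_mx _.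
apply/eqP; rewrite -subr_eq; apply/eqP/(can_inj mxvecK).
by rewrite -LE vec_mxK mulmxKV.
Qed.

Lemma lyapunov_unique n (M X S S' : 'M[F]_n) : power_stable M ->
  S = X + M *m S *m M^T -> S' = X + M *m S' *m M^T -> S = S'.
Proof.
move=> sM SE S'E; apply/subr0_eq/(stein_eq0 sM (power_stable_tr sM)).
by rewrite {1}SE {1}S'E opprD addrACA subrr add0r mulmxBr mulmxBl.
Qed.

Lemma lyapunov_iter n (M X S : 'M[F]_n) k : S = X + M *m S *m M^T ->
  S = \sum_(j < k) (M ^+ j *m X *m (M ^+ j)^T) + M ^+ k *m S *m (M ^+ k)^T.
Proof.
move=> SE; elim: k => [|k IHk].
  by rewrite big_ord0 add0r expr0 trmx1 mulmx1 mul1mx.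
rewrite {1}IHk big_ord_recr /= -addrA; congr (_ + _).
by rewrite {1}SE mulmxDr mulmxDl mulmxXSr trmx_mul !mulmxA.
Qed.

(** The remainder in [lyapunov_iter] tends to zero and the partial sums are
    nonnegative. *)
Lemma lyapunov_psd n (M X S : 'M[F]_n) : power_stable M -> sym_psd X ->
  S = X + M *m S *m M^T -> sym_psd S.
Proof.
move=> sM [sX pX] SE; split=> [|v].
  apply: (lyapunov_unique sM _ SE); rewrite {1}SE linearD /= sX.
  by rewrite !trmx_mul trmxK !mulmxA.
apply: (ler_cvg_to (power_stable_quad S v (power_stable_tr sM)) (cvg_cst _)).
apply: nearW => k; rewrite {2}(lyapunov_iter k SE) quad_formD.
rewrite quad_form_congrV trmxX lerDr.
rewrite quad_form_sum; apply: sumr_ge0 => j _.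
by rewrite quad_form_congrV.
Qed.

(** The two equations are adjoint for the trace pairing; this is the equality of
    the two expressions of the cost. *)
Lemma lyapunov_trace n (M H X S P : 'M[F]_n) :
  S = X + M *m S *m M^T -> P = H + M^T *m P *m M -> \tr (H *m S) = \tr (P *m X).
Proof.
move=> SE PE.
have -> : H = P - M^T *m P *m M by rewrite {1}PE addrK.
have -> : X = S - M *m S *m M^T by rewrite {1}SE addrK.
rewrite mulmxBl mulmxBr ![\tr (_ - _)]linearB /=; congr (_ - _).
by rewrite -!mulmxA mxtrace_mulC !mulmxA.
Qed.

(** Along a trajectory the value of [P] decreases by the value of [H], so the
    latter tends to zero; so does its sum over [N] consecutive times, which by
    assumption dominates the square norm of the state. *)
Lemma lyapunov_stable n (M P H : 'M[F]_n) N :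
  sym_psd P -> sym_psd H -> P = H + M^T *m P *m M ->
  sym_pd (\sum_(j < N) (M ^+ j)^T *m H *m M ^+ j) -> power_stable M.
Proof.
move=> [sP pP] [sH pH] PE pW.
have step v : quad_form P v = quad_form H v + quad_form P (M *m v).
  by rewrite {1}PE quad_formD quad_form_congr.
have Hk v : quad_form H (M ^+ k *m v) @[k --> \oo] --> (0 : F).
  pose a k := quad_form P (M ^+ k *m v).
  have aS k : quad_form H (M ^+ k *m v) = a k - a k.+1.
    by rewrite /a mulmxXS -mulmxA step addrK.
  have acvg : cvgn a.
    apply: nonincreasing_is_cvgn.
      apply/nonincreasing_seqP => k; rewrite -subr_ge0 -aS; exact: pH.
    by exists 0 => _ [k _ <-]; apply: pP.
  under eq_fun do rewrite aS.
  have : a k - a k.+1 @[k --> \oo] --> limn a - limn a.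
    by apply: cvgB => //; rewrite (cvg_shiftS a).
  by rewrite subrr.
have Wk v : quad_form (\sum_(j < N) (M ^+ j)^T *m H *m M ^+ j) (M ^+ k *m v)
    @[k --> \oo] --> (0 : F).
  suff: \sum_(j < N) quad_form ((M ^+ j)^T *m H *m M ^+ j) (M ^+ k *m v)
      @[k --> \oo] --> \sum_(j < N) (0 : F).
    by rewrite big1_eq; under eq_fun do rewrite -quad_form_sum.
  apply: cvg_sumr => j _; under eq_fun do rewrite quad_form_congr.
  have -> : (fun k => quad_form H (M ^+ j *m (M ^+ k *m v))) =
            (fun k => quad_form H (M ^+ k *m (M ^+ j *m v))).
    by apply/funext => k; rewrite !mulmxA -![_ ^+ _ *m _ ^+ _]/(_ ^+ _ * _ ^+ _)
      -!exprD addnC.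
  exact: Hk.
have [c c0 cW] := sym_pd_coercive pW.
move=> i j; rewrite mxE; apply/norm_cvg0P.
have sq : ((M ^+ k) i j) ^+ 2 @[k --> \oo] --> (0 : F).
  apply: (@squeeze_cvgr _ _ _ _ (fun=> 0) (fun k => c * quad_form
     (\sum_(j < N) (M ^+ j)^T *m H *m M ^+ j) (M ^+ k *m delta_mx j ord0))).
  - apply: nearW => k; rewrite sqr_ge0 /=; apply: le_trans (cW _).
    apply: le_trans (sqnorm_entry _ i).
    by rewrite -colE mxE.
  - exact: cvg_cst.
  - by rewrite -[X in _ --> X](mulr0 c); apply: cvgMr; apply: Wk.
have := continuous_cvg _ (@sqrt_continuous F 0) sq; rewrite sqrtr0 => sq'.
by under eq_fun do rewrite -sqrtr_sqr; apply: sq'.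
Qed.

End Lyapunov.

(** * The spectral radius *)

Section SpectralRadius.
Variable F : realType.

(** The term [c / (r - rho)] makes the bound reproduce itself: [rho] times it
    plus [c] is [r] times it. *)
Lemma linear_recurrence_bound (K : numFieldType) (a b : nat -> K)
    (z rho r c : K) :
  `|z| <= rho -> rho < r -> 0 <= c -> (forall k, a k.+1 = z * a k + b k) ->
  (forall k, `|b k| <= c * r ^+ k) ->
  forall k, `|a k| <= (`|a 0%N| + c / (r - rho)) * r ^+ k.
Proof.
move=> zrho rhor c0 aS bc; have rho0 : 0 <= rho := le_trans (normr_ge0 z) zrho.
have r0 : 0 < r := le_lt_trans rho0 rhor.
have d0 : 0 < r - rho by rewrite subr_gt0.
elim=> [|k IHk]; first by rewrite expr0 mulr1 lerDl divr_ge0 // ltW.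
rewrite aS (le_trans (ler_normD _ _)) // normrM.
have le1 : `|z| * `|a k| <= rho * ((`|a 0%N| + c / (r - rho)) * r ^+ k).
  by apply: ler_pM.
apply: le_trans (lerD le1 (bc k)) _.
have -> : (`|a 0%N| + c / (r - rho)) * r ^+ k.+1 =
    rho * ((`|a 0%N| + c / (r - rho)) * r ^+ k) + c * r ^+ k
    + `|a 0%N| * (r - rho) * r ^+ k.
  by rewrite exprS; field; rewrite gt_eqF.
by rewrite lerDl mulr_ge0 ?mulr_ge0 ?exprn_ge0 // ltW.
Qed.

(** The roots are removed one at a time: [(M - z) Y] is annihilated by the
    remaining factors, and the entries of [M ^+ k *m Y] follow a scalar recurrence
    of ratio [z] driven by those of [M ^+ k *m (M - z) Y]. *)
Lemma power_bound_annihilated (K : numFieldType) n p (M : 'M[K]_n.+1)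
    (rho r : K) (zs : seq K) :
  rho < r -> 0 <= rho -> (forall z, z \in zs -> `|z| <= rho) ->
  forall Y : 'M[K]_(n.+1, p),
  horner_mx M (\prod_(z <- zs) ('X - z%:P)) *m Y = 0 ->
  exists2 c, 0 <= c & forall k i j, `|(M ^+ k *m Y) i j| <= c * r ^+ k.
Proof.
move=> rhor rho0; have r0 : 0 < r := le_lt_trans rho0 rhor.
elim: zs => [|z zs IHzs] zrho Y.
  rewrite big_nil rmorph1 mul1mx => ->; exists 0 => // k i j.
  by rewrite mulmx0 mxE normr0 mul0r.
rewrite big_cons mulrC rmorphM rmorphB /= horner_mx_X horner_mx_C -[_ * _]/(_ *m _).
rewrite -mulmxA; set W := (M - z%:M) *m Y => /IHzs[|c c0 cP].
  by move=> t tzs; apply: zrho; rewrite inE tzs orbT.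
have d0 : 0 < r - rho by rewrite subr_gt0.
exists (\sum_i \sum_j `|Y i j| + c / (r - rho)).
  rewrite addr_ge0 ?divr_ge0 ?(ltW d0) // sumr_ge0 // => i _; exact: sumr_ge0.
move=> k i j.
have zr : `|z| <= rho by apply: zrho; rewrite inE eqxx.
have rec k' : (M ^+ k'.+1 *m Y) i j = z * (M ^+ k' *m Y) i j + (M ^+ k' *m W) i j.
  rewrite /W mulmxBl mul_scalar_mx mulmxBr -scalemxAr exprSr -[_ * M]/(_ *m M).
  by rewrite -mulmxA !mx_entryE addrC subrK.
have := linear_recurrence_bound zr rhor c0 rec (fun k' => cP k' i j) k.
move=> /le_trans; apply; apply: ler_wpM2r; first by rewrite exprn_ge0 ?ltW.
rewrite lerD2r.
rewrite expr0 mul1mx (bigD1 i) //= (bigD1 j) //= -addrA lerDl addr_ge0 //.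
  exact: sumr_ge0.
by apply: sumr_ge0 => l _; apply: sumr_ge0.
Qed.

Lemma normc_Re (z : F[i]) : `|z| = (complex.Re `|z|)%:C%C.
Proof. by case: z => a b; rewrite normc_def. Qed.

(** By Cayley-Hamilton the characteristic polynomial, split over [F[i]],
    annihilates [M], and the moduli of its roots are bounded by the spectral
    radius.  The rate [r] is taken strictly between that bound and 1. *)
Lemma spectral_radius_power_stable n (M : 'M[F]_n) :
  spectral_radius M < 1 -> power_stable M.
Proof.
case: n M => [|n] M; first by move=> _ [].
rewrite /spectral_radius; set S := [set r | _] => srM.
pose Mc := map_mx (real_complex F) M.
have [zs zsE] := closed_field_poly_normal (char_poly Mc).
rewrite (monicP (char_poly_monic Mc)) scale1r in zsE.
have eig z : eigenvalue Mc z = (z \in zs).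
  by rewrite eigenvalue_root_char zsE root_prod_XsubC.
have Re_ge0 (z : F[i]) : 0 <= complex.Re `|z|.
  by have := normr_ge0 z; rewrite normc_Re lecR.
have Sub : has_ubound S.
  exists (\sum_(z <- zs) complex.Re `|z|) => _ [z zE ->].
  rewrite -/Mc eig in zE; rewrite (perm_big _ (perm_to_rem zE)) big_cons lerDl.
  by apply: sumr_ge0.
(* The maximum with 0 makes the bound nonnegative without inspecting [S]. *)
pose rho := Num.max 0 (sup S); pose r := (1 + rho) / 2.
have rho1 : rho < 1 by rewrite /rho gt_max ltr01.
have rho0 : 0 <= rho by rewrite le_max lexx.
have zrho z : z \in zs -> `|z| <= rho%:C%C.
  move=> zzs; rewrite normc_Re lecR le_max; apply/orP; right.
  have Sz : S (complex.Re `|z|) by exists z; rewrite ?eig.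
  by apply: sup_upper_bound => //; split=> //; exists (complex.Re `|z|).
have rhor : rho < r by rewrite /r; lra.
have r1 : r < 1 by rewrite /r; lra.
have [] := @power_bound_annihilated _ n n.+1 Mc rho%:C%C r%:C%C zs _ _ zrho 1%:M.
- by rewrite ltcR.
- by rewrite lecR.
- by rewrite mulmx1 -zsE Cayley_Hamilton.
move=> c c0 cP i j; rewrite mxE; apply/norm_cvg0P.
apply: (@squeeze_cvgr _ _ _ _ (fun=> 0) (geometric (complex.Re c) r)).
- apply: nearW => k; rewrite normr_ge0 /=.
  have := cP k i j; rewrite mulmx1 -rmorphXn /= mxE normc_Re.
  rewrite normc_def /= expr0n addr0 sqrtr_sqr.
  by rewrite -[in X in X -> _](RRe_real (ger0_real c0)) -rmorphXn -rmorphM lecR.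
- exact: cvg_cst.
- by apply: cvg_geometric; rewrite ger0_norm // ltW // (le_lt_trans rho0).
Qed.


Lemma eigenvalue_conj (K : fieldType) n (M T : 'M[K]_n) z : T \in unitmx ->
  eigenvalue (T *m M *m invmx T) z = eigenvalue M z.
Proof.
move=> uT; apply/eigenvalueP/eigenvalueP => [[v vE v0]|[v vE v0]].
  exists (v *m T); last first.
    by apply: contra_neq v0 => vT0; rewrite -[v](mulmxK uT) vT0 mul0mx.
  rewrite -[LHS](mulmxKV uT) (_ : v *m T *m M *m invmx T = z *: v).
    by rewrite scalemxAl.
  by rewrite -vE !mulmxA.
exists (v *m invmx T).
  by rewrite !mulmxA mulmxKV // vE scalemxAl.
by apply: contra_neq v0 => vT0; rewrite -[v](mulmxKV uT) vT0 mul0mx.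
Qed.

Lemma spectral_radius_conj n (M T : 'M[F]_n) : T \in unitmx ->
  spectral_radius (T *m M *m invmx T) = spectral_radius M.
Proof.
move=> uT; apply: (congr1 sup); apply/seteqP.
have uTc : map_mx (real_complex F) T \in unitmx by rewrite map_unitmx.
have key z : eigenvalue (map_mx (real_complex F) (T *m M *m invmx T)) z =
    eigenvalue (map_mx (real_complex F) M) z.
  by rewrite 2!map_mxM map_invmx; apply: eigenvalue_conj.
split=> r [z zM rE]; (exists z; [|exact: rE]).
- by rewrite -key.
- by rewrite key.
Qed.

End SpectralRadius.

(** * The discrete algebraic Riccati equation *)

Section Riccati.
Variables (F : realType) (n m : nat).
Variables (A : 'M[F]_n) (B : 'M[F]_(n, m)) (Q : 'M[F]_n) (R : 'M[F]_m).
Hypotheses (psdQ : sym_psd Q) (pdR : sym_pd R).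

Definition riccati_map (P : 'M[F]_n) : 'M[F]_n :=
  Q + A^T *m P *m A
    - A^T *m P *m B *m invmx (R + B^T *m P *m B) *m B^T *m P *m A.

Lemma riccati_weight_pd P : sym_psd P -> sym_pd (R + B^T *m P *m B).
Proof. by move=> psdP; apply: sym_pdD pdR (sym_psd_congr _ psdP). Qed.

Lemma riccati_gainE P : sym_psd P ->
  (R + B^T *m P *m B) *m ctrl_gain A B R P = B^T *m P *m A.
Proof.
move=> psdP; rewrite /ctrl_gain !mulmxA mulmxV ?mul1mx //.
exact/sym_pd_unit/riccati_weight_pd.
Qed.

(** Completing the square in the control.  The identity is stated for matrices
    [X] and [U] rather than vectors because it is also needed for block rows, where
    it expresses the cost of a dynamic controller. *)
Lemma riccati_square P p (X : 'M[F]_(n, p)) (U : 'M[F]_(m, p)) : sym_psd P ->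
  X^T *m Q *m X + U^T *m R *m U
    + (A *m X + B *m U)^T *m P *m (A *m X + B *m U) =
  X^T *m riccati_map P *m X
    + (U + ctrl_gain A B R P *m X)^T *m (R + B^T *m P *m B)
      *m (U + ctrl_gain A B R P *m X).
Proof.
move=> psdP; have gE := riccati_gainE psdP.
have [sS _] := riccati_weight_pd psdP; have [sP _] := psdP.
set S := R + _ in gE sS *; set K := ctrl_gain A B R P in gE *.
have gE' : K^T *m S = A^T *m P *m B.
  by rewrite -sS -trmx_mul gE !trmx_mul trmxK sP mulmxA.
have -> : riccati_map P = Q + A^T *m P *m A - K^T *m S *m K.
  by rewrite gE' /K /ctrl_gain /riccati_map !mulmxA.
have -> : (U + K *m X)^T *m S *m (U + K *m X) =
    U^T *m S *m U + U^T *m (S *m K) *m X + X^T *m (K^T *m S) *m U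
    + X^T *m (K^T *m S *m K) *m X.
  by mx_expand; mx_abel.
by rewrite gE gE' /S; mx_expand; mx_abel.
Qed.

Lemma riccati_quad P x u : sym_psd P ->
  quad_form Q x + quad_form R u + quad_form P (A *m x + B *m u) =
  quad_form (riccati_map P) x
    + quad_form (R + B^T *m P *m B) (u + ctrl_gain A B R P *m x).
Proof.
by move=> psdP; rewrite /quad_form -!mx_entryD riccati_square.
Qed.

(** The square vanishes for the optimal feedback. *)
Lemma riccati_map_closed_loop P : sym_psd P ->
  let K := ctrl_gain A B R P in
  riccati_map P = Q + K^T *m R *m K + (A - B *m K)^T *m P *m (A - B *m K).
Proof.
move=> psdP K; have := riccati_square 1%:M (- K) psdP.
rewrite /K !mulmx1 addNr trmx0 !mul0mx addr0 trmx1 !mul1mx => <-.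
by rewrite mulmxN; mx_expand; mx_abel.
Qed.

Lemma riccati_map_psd P : sym_psd P -> sym_psd (riccati_map P).
Proof.
move=> psdP; rewrite riccati_map_closed_loop //.
by do 2?apply: sym_psdD => //; apply: sym_psd_congr => //; apply: sym_pd_psd.
Qed.

Lemma riccati_map_le P x u : sym_psd P -> quad_form (riccati_map P) x <=
  quad_form Q x + quad_form R u + quad_form P (A *m x + B *m u).
Proof.
move=> psdP; rewrite riccati_quad // lerDl.
by have [] := sym_pd_psd (riccati_weight_pd psdP).
Qed.

(** The optimal feedback for [P'] is a competitor in the minimization that defines
    the Riccati map of [P]. *)
Lemma riccati_map_mono P P' : sym_psd P -> sym_psd P' ->
  (forall v, quad_form P v <= quad_form P' v) ->
  forall v, quad_form (riccati_map P) v <= quad_form (riccati_map P') v.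
Proof.
move=> psdP psdP' PP' v; have := riccati_quad v (- (ctrl_gain A B R P' *m v)) psdP'.
rewrite addNr quad_formv0 addr0 => <-.
apply: le_trans (riccati_map_le _ (- (ctrl_gain A B R P' *m v)) psdP) _.
by rewrite lerD2l.
Qed.

Section Uniqueness.
Hypothesis obsQ :
  forall v, (forall k, (k < n)%N -> quad_form Q (A ^+ k *m v) = 0) -> v = 0.

Let closed_loop P := A - B *m ctrl_gain A B R P.

(** Where the running cost vanishes the control does too, since [R] is positive
    definite, and the closed loop follows the free motion. *)
Lemma closed_loop_unforced P v : sym_psd P ->
  quad_form (Q + (ctrl_gain A B R P)^T *m R *m ctrl_gain A B R P) v = 0 ->
  quad_form Q v = 0 /\ closed_loop P *m v = A *m v.
Proof.
move=> psdP; rewrite quad_formD quad_form_congr => /eqP.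
have [_ pQ] := psdQ; have [_ pR] := sym_pd_psd pdR.
rewrite paddr_eq0 // => /andP[/eqP Qv /eqP RKv]; split=> //.
rewrite /closed_loop mulmxBl -mulmxA [ctrl_gain _ _ _ _ *m v](_ : _ = 0).
  by rewrite mulmx0 subr0.
apply/eqP/negPn/negP => nz; have [_ /(_ _ nz)] := pdR.
by rewrite RKv ltxx.
Qed.

(** A zero of [P] produces a free motion of zero cost, excluded by
    observability. *)
Lemma riccati_psd_pd P : sym_psd P -> P = riccati_map P -> sym_pd P.
Proof.
move=> psdP PE; apply: sym_psd_pd => // v Pv0; apply: obsQ.
have [_ pP] := psdP.
have [_ pH] : sym_psd (Q + (ctrl_gain A B R P)^T *m R *m ctrl_gain A B R P).
  by apply: sym_psdD => //; apply/sym_psd_congr/sym_pd_psd.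
suff: forall k, quad_form P (A ^+ k *m v) = 0.
  move=> Pk k _; have /eqP := Pk k.
  rewrite {1}PE riccati_map_closed_loop // quad_formD quad_form_congr.
  by rewrite paddr_eq0 // => /andP[/eqP/(closed_loop_unforced psdP)[]].
elim=> [|k IHk]; first by rewrite expr0 mul1mx.
move: IHk => /eqP; rewrite {1}PE riccati_map_closed_loop // quad_formD quad_form_congr.
rewrite paddr_eq0 // => /andP[/eqP/(closed_loop_unforced psdP)[_ clE] /eqP].
by rewrite -/(closed_loop P) clE mulmxXS -mulmxA.
Qed.

Lemma riccati_closed_loop_stable P : sym_psd P -> P = riccati_map P ->
  power_stable (closed_loop P).
Proof.
move=> psdP PE.
have psdH : sym_psd (Q + (ctrl_gain A B R P)^T *m R *m ctrl_gain A B R P).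
  by apply: sym_psdD => //; apply/sym_psd_congr/sym_pd_psd.
have PE' := riccati_map_closed_loop psdP; rewrite /= -PE in PE'.
apply: (lyapunov_stable (N := n) psdP psdH PE').
apply: sym_psd_pd; first by apply: sym_psd_sum => j _; apply: sym_psd_congr.
move=> v; rewrite quad_form_sum => W0; apply: obsQ.
have H0 k : (k < n)%N ->
    quad_form (Q + (ctrl_gain A B R P)^T *m R *m ctrl_gain A B R P)
      (closed_loop P ^+ k *m v) = 0.
  move=> kn; rewrite -quad_form_congr.
  apply: (psumr_eq0P _ W0 (i := Ordinal kn)) => // i _.
  by have [_] := sym_psd_congr (closed_loop P ^+ i) psdH; apply.
have clE k : (k <= n)%N -> closed_loop P ^+ k *m v = A ^+ k *m v.
  elim: k => [|k IHk] kn //; rewrite !mulmxXS -!mulmxA -IHk ?(ltnW kn) //.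
  by have [] := closed_loop_unforced psdP (H0 k kn).
by move=> k kn; rewrite -clE ?(ltnW kn) //; have [] := closed_loop_unforced psdP (H0 k kn).
Qed.

(** The difference satisfies [P1 - P2 = A1^T (P1 - P2) A2], where [A1] and [A2]
    are the two stable closed loops. *)
Lemma riccati_unique P1 P2 : sym_psd P1 -> sym_psd P2 ->
  P1 = riccati_map P1 -> P2 = riccati_map P2 -> P1 = P2.
Proof.
move=> psd1 psd2 E1 E2; apply/subr0_eq.
have s1 := riccati_closed_loop_stable psd1 E1.
have s2 := riccati_closed_loop_stable psd2 E2.
apply: (stein_eq0 (power_stable_tr s1) s2).
rewrite /closed_loop; have g1 := riccati_gainE psd1; have g2 := riccati_gainE psd2.
have e1 : P1 = Q + A^T *m P1 *m A - A^T *m P1 *m B *m ctrl_gain A B R P1.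
  by rewrite {1}E1 /riccati_map /ctrl_gain !mulmxA.
have e2 : P2 = Q + A^T *m P2 *m A - A^T *m P2 *m B *m ctrl_gain A B R P2.
  by rewrite {1}E2 /riccati_map /ctrl_gain !mulmxA.
set K1 := ctrl_gain A B R P1 in g1 e1 *; set K2 := ctrl_gain A B R P2 in g2 e2 *.
have [sP1 _] := psd1; have [sP2 _] := psd2; have [sR _] := pdR; have [sQ _] := psdQ.
have g1' : K1^T *m (R + B^T *m P1 *m B) = A^T *m P1 *m B.
  have [sS _] := riccati_weight_pd psd1.
  by rewrite -sS -trmx_mul g1 !trmx_mul trmxK sP1 mulmxA.
have e1' : P1 = Q + A^T *m P1 *m A - K1^T *m B^T *m P1 *m A.
  by rewrite -sP1 {1}e1; mx_expand; rewrite sQ sP1.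
have -> : (A - B *m K1)^T *m (P1 - P2) *m (A - B *m K2) =
  (A^T *m P1 *m A - K1^T *m B^T *m P1 *m A)
  - (A^T *m P1 *m B *m K2 - K1^T *m (B^T *m P1 *m B) *m K2)
  - (A^T *m P2 *m A - A^T *m P2 *m B *m K2)
  + (K1^T *m (B^T *m P2 *m A) - K1^T *m (B^T *m P2 *m B) *m K2).
  by mx_expand; mx_abel.
rewrite -g1' -g2 {1}e1' {1}e2; mx_expand; mx_abel.
Qed.

End Uniqueness.

Section Existence.
Variable D : nat -> 'M[F]_(m, n).
Hypothesis steering : \sum_(k < n) A ^+ k *m B *m D k = 1%:M.

Definition riccati_iter k := iter k riccati_map 0.

Lemma riccati_iter_psd k : sym_psd (riccati_iter k).
Proof. by elim: k => [|k IHk]; [apply: sym_psd0|apply: riccati_map_psd]. Qed.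

Lemma riccati_iter_mono k v :
  quad_form (riccati_iter k) v <= quad_form (riccati_iter k.+1) v.
Proof.
elim: k v => [|k IHk] v; last first.
  exact: (riccati_map_mono (riccati_iter_psd k) (riccati_iter_psd k.+1) IHk).
by rewrite quad_form0; have [_] := riccati_iter_psd 1; apply.
Qed.

(** Value iteration is bounded by the cost of any control sequence that steers the
    state to the origin, where all the iterates vanish; the [D k] provide one. *)
Lemma riccati_iter_bounded v : exists c, forall k, quad_form (riccati_iter k) v <= c.
Proof.
suff steer N x (u : nat -> 'cV[F]_m) :
    A ^+ N *m x + \sum_(k < N) A ^+ k *m B *m u k = 0 ->
    exists c, forall k, quad_form (riccati_iter k) x <= c.
  apply: (steer n v (fun k => - (D k *m (A ^+ n *m v)))).
  under eq_bigr do rewrite mulmxN (mulmxA _ (D _)).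
  by rewrite sumrN -mulmx_suml steering mul1mx subrr.
elim: N x => [|N IHN] x.
  by rewrite expr0 mul1mx big_ord0 addr0 => ->; exists 0 => k; rewrite quad_formv0.
rewrite big_ord_recr /= addrA addrAC mulmxXSr -!mulmxA -mulmxDr => /IHN[c cP].
exists (Num.max 0 (quad_form Q x + quad_form R (u N) + c)) => -[|k].
  by rewrite quad_form0 le_max lexx.
rewrite le_max; apply/orP; right.
by apply: le_trans (riccati_map_le x (u N) (riccati_iter_psd k)) _; rewrite lerD2l.
Qed.

(** The iterates increase as quadratic forms and are bounded, so their values
    converge, and by polarization their entries do.  The inverse in the Riccati map
    stays continuous because its argument dominates [R]. *)
Lemma riccati_exists : exists P, sym_psd P /\ P = riccati_map P.
Proof.
have cvgq v : cvgn (fun k => quad_form (riccati_iter k) v).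
  apply: nondecreasing_is_cvgn.
    by apply/nondecreasing_seqP => k; apply: riccati_iter_mono.
  by have [c cP] := riccati_iter_bounded v; exists c => _ [k _ <-].
pose e i : 'cV[F]_n := delta_mx i ord0.
have entryE (M : 'M[F]_n) i j : M^T = M ->
    M i j = (quad_form M (e i + e j) - quad_form M (e i) - quad_form M (e j)) / 2.
  move=> sM; rewrite quad_form_vD (bilin_sym (e i) (e j) sM).
  have -> : M i j = ((e i)^T *m M *m e j) ord0 ord0.
    by rewrite trmx_delta -rowE -colE !mxE.
  by field.
have cvge i j : cvgn (fun k => riccati_iter k i j).
  have -> : (fun k => riccati_iter k i j) = fun k => (quad_form (riccati_iter k) (e i + e j)
     - quad_form (riccati_iter k) (e i) - quad_form (riccati_iter k) (e j)) / 2.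
    by apply/funext => k; rewrite entryE //; have [] := riccati_iter_psd k.
  by apply: is_cvgMl; apply: is_cvgB => //; apply: is_cvgB.
pose P : 'M[F]_n := \matrix_(i, j) limn (fun k => riccati_iter k i j).
have cvgP : mcvg riccati_iter P by move=> i j; rewrite mxE; apply: cvge.
have psdP : sym_psd P.
  split=> [|v].
    apply: (mcvg_unique (mcvg_tr cvgP)); apply: mcvg_eq cvgP => k.
    by have [] := riccati_iter_psd k.
  have cq : quad_form (riccati_iter k) v @[k --> \oo] --> quad_form P v.
    exact: mcvg_quad.
  apply: (cvgr_to_ge cq).
  by apply: nearW => k; have [_] := riccati_iter_psd k; apply.
exists P; split=> //.
have shift : mcvg (fun k => riccati_iter k.+1) P.
  by move=> i j; rewrite (cvg_shiftS (fun k => riccati_iter k i j)).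
apply: (mcvg_unique shift); rewrite /= /riccati_map.
have cst p q (M : 'M[F]_(p, q)) : mcvg (fun=> M) M by apply: mcvg_cst.
have unitS P' : sym_psd P' -> R + B^T *m P' *m B \in unitmx.
  by move=> psdP'; apply/sym_pd_unit/riccati_weight_pd.
have cvgS : mcvg (fun k => R + B^T *m riccati_iter k *m B) (R + B^T *m P *m B).
  exact: mcvgD (cst _ _ R) (mcvgM (mcvgM (cst _ _ B^T) cvgP) (cst _ _ B)).
have cvgI := mcvg_inv (fun k => unitS _ (riccati_iter_psd k)) (unitS _ psdP) cvgS.
have cvgAP := mcvgM (cst _ _ A^T) cvgP.
have cvgPA := mcvgM cvgP (cst _ _ A).
apply: mcvgD; first exact: mcvgD (cst _ _ Q) (mcvgM cvgAP (cst _ _ A)).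
apply: mcvgN.
exact: (mcvgM (mcvgM (mcvgM (mcvgM (mcvgM cvgAP (cst _ _ B)) cvgI) (cst _ _ B^T))
  cvgP) (cst _ _ A)).
Qed.

End Existence.

End Riccati.

(** * First-order perturbation of Lyapunov equations *)

Definition pencil (F : realType) n (Y0 Y1 Y2 : 'M[F]_n) (h : F) :=
  Y0 + h *: Y1 + h ^+ 2 *: Y2.

(** The derivative of [M^T *m P *m M] with respect to [M], along [E]. *)
Definition congr_derivative (F : realType) n (E M P : 'M[F]_n) :=
  E^T *m P *m M + M^T *m P *m E.

Section Perturbation.
Variables (F : realType) (n : nat).
Variables (M E Q0 Q1 Q2 X0 X1 X2 : 'M[F]_n).
Hypothesis stM : power_stable M.

Let Mh (h : F) := M + h *: E.
Hypothesis psdX : forall h, sym_psd (pencil X0 X1 X2 h).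

Let cross := congr_derivative E M.

Lemma congr_pencil P h : (Mh h)^T *m P *m Mh h =
  M^T *m P *m M + h *: cross P + h ^+ 2 *: (E^T *m P *m E).
Proof.
rewrite /Mh /cross /congr_derivative; mx_expand.
by rewrite -?(scalemxAl, scalemxAr) scalerDr expr2 -scalerA; mx_abel.
Qed.

Lemma trace_pencil (Y Y0 Y1 Y2 : 'M[F]_n) h : \tr (Y *m pencil Y0 Y1 Y2 h) =
  \tr (Y *m Y0) + h * \tr (Y *m Y1) + h ^+ 2 * \tr (Y *m Y2).
Proof. by rewrite !mulmxDr -!scalemxAr !mxtraceD !mxtraceZ. Qed.

(** The solution [S] is never differentiated.  The costs are compared through the
    unperturbed dual solution [P]: their difference is the trace of [P] against
    the change of the source, plus the trace of the change of [Q] and of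
    [M^T *m P *m M] against the perturbed solution [Sh].  To first order the last
    trace is [tr (G1 Sh)], and the same comparison with the dual solution [PG] of
    source [G1] replaces [Sh] by [S].  What remains is of second order provided
    [tr Sh] is bounded; the dual solution [PI] of source 1 is a Lyapunov function
    for all the nearby matrices and gives both this bound and their stability. *)
Lemma lyapunov_perturbation P S :
  P = Q0 + M^T *m P *m M -> S = X0 + M *m S *m M^T ->
  exists d C, 0 < d /\ forall h, `|h| < d -> power_stable (Mh h) /\
    forall Sh, Sh = pencil X0 X1 X2 h + Mh h *m Sh *m (Mh h)^T ->
    `|\tr (pencil Q0 Q1 Q2 h *m Sh) - \tr (Q0 *m S)
      - h * (\tr (P *m X1) + \tr ((Q1 + cross P) *m S))| <= C * h ^+ 2.
Proof.
move=> PE SE.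
have dual (G : 'M[F]_n) : exists PG, PG = G + M^T *m PG *m M.
  by have := lyapunov_exists G (power_stable_tr stM); rewrite trmxK.
have [PI PIE] := dual 1%:M.
have psdPI : sym_psd PI.
  by apply: (lyapunov_psd (power_stable_tr stM) (sym_pd_psd (sym_pd1 F n)));
    rewrite trmxK.
set G1 := Q1 + cross P; set G2 := Q2 + E^T *m P *m E.
have [PG PGE] := dual G1.
have [c1 c1_0 c1P] := quad_form_bound (cross PI).
have [c2 c2_0 c2P] := quad_form_bound (E^T *m PI *m E).
have [b1 b1_0 b1P] := trace_bound G2.
have [b2 b2_0 b2P] := trace_bound (cross PG).
have [b3 b3_0 b3P] := trace_bound (E^T *m PG *m E).
pose s := 2 * (`|\tr (PI *m X0)| + `|\tr (PI *m X1)| + `|\tr (PI *m X2)|).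
(* For such steps [PI] still decreases by at least half the square norm. *)
pose d := (2 * (1 + c1 + c2))^-1.
exists d, (`|\tr (P *m X2)| + b1 * s + `|\tr (PG *m X1)| + `|\tr (PG *m X2)|
  + b2 * s + b3 * s).
have d0 : 0 < d by rewrite invr_gt0 mulr_gt0 // !ltr_pwDl.
split=> // h hd.
have h1 : `|h| <= 1.
  apply: le_trans (ltW hd) _; rewrite invf_le1; last by rewrite mulr_gt0 // !ltr_pwDl.
  by lra.
have h2 : h ^+ 2 <= `|h|.
  by rewrite -[h ^+ 2]ger0_norm ?sqr_ge0 // normrX expr2 ler_piMr.
pose H := PI - (Mh h)^T *m PI *m Mh h.
have quadH v : quad_form 1%:M v <= 2 * quad_form H v.
  have -> : H = 1%:M - h *: cross PI - h ^+ 2 *: (E^T *m PI *m E).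
    by rewrite /H congr_pencil {1}PIE; move: (cross PI) => Z; mx_abel.
  rewrite !quad_formB !quad_formZ.
  have := c1P v; have := c2P v; have := sqnorm_ge0 v.
  set q := quad_form 1%:M v; set q1 := quad_form (cross PI) v.
  set q2 := quad_form _ v.
  move=> q0 q2P q1P.
  have hd2 : `|h| * (c1 + c2) <= 1 / 2.
    have : `|h| * (2 * (1 + c1 + c2)) <= 1.
      have /ltW := hd; rewrite -ler_pdivlMr ?mulr_gt0 ?ltr_pwDl //.
      by rewrite div1r.
    have := normr_ge0 h; nra.
  have t1 : h * q1 <= `|h| * (c1 * q).
    by apply: le_trans (ler_norm _) _; rewrite normrM ler_wpM2l.
  have t2 : h ^+ 2 * q2 <= `|h| * (c2 * q).
    apply: le_trans (ler_norm _) _; rewrite normrM.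
    by apply: ler_pM => //; rewrite ger0_norm ?sqr_ge0.
  have := ler_wpM2r q0 hd2; nra.
have psdH : sym_psd H.
  have [sPI _] := psdPI.
  split=> [|v]; first by rewrite /H; mx_expand; rewrite sPI.
  by have := quadH v; have := sqnorm_ge0 v; lra.
have pdH : sym_pd H.
  have [sH _] := psdH; split=> // v v0.
  by have := quadH v; have := sqnorm_gt0 v0; lra.
have PIEh : PI = H + (Mh h)^T *m PI *m Mh h by rewrite /H subrK.
have stMh : power_stable (Mh h).
  apply: (lyapunov_stable (N := 1) psdPI psdH PIEh).
  by rewrite big_ord1 expr0 trmx1 mul1mx mulmx1.
split=> // Sh ShE.
have psdSh := lyapunov_psd stMh (psdX h) ShE.
have trSh : \tr Sh <= s.
  have eqT := lyapunov_trace ShE PIEh.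
  have : 0 <= \tr ((2 *: H - 1%:M) *m Sh).
    apply: psd_trace_ge0 => // v; rewrite quad_formB quad_formZ subr_ge0.
    exact: quadH.
  rewrite mulmxBl -scalemxAl mul1mx mxtraceBE mxtraceZ eqT.
  rewrite trace_pencil subr_ge0 => /le_trans; apply; rewrite /s ler_wpM2l //.
  apply: lerD; first apply: lerD; first exact: ler_norm.
    by apply: le_trans (ler_norm _) _; rewrite normrM ler_piMl.
  apply: le_trans (ler_norm _) _; rewrite normrM ler_piMl //.
  by rewrite ger0_norm ?sqr_ge0 // (le_trans h2).
have defect (Z Y : 'M[F]_n) : Z = Y + M^T *m Z *m M ->
    \tr (Y *m Sh) = \tr (Z *m pencil X0 X1 X2 h)
      + h * \tr (cross Z *m Sh) + h ^+ 2 * \tr (E^T *m Z *m E *m Sh).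
  move=> ZE.
  have eZ : Z = (Z - (Mh h)^T *m Z *m Mh h) + (Mh h)^T *m Z *m Mh h by rewrite subrK.
  rewrite -(lyapunov_trace ShE eZ).
  have -> : Z - (Mh h)^T *m Z *m Mh h = Y - h *: cross Z - h ^+ 2 *: (E^T *m Z *m E).
    by rewrite congr_pencil {1}ZE; move: (cross Z) => W; mx_abel.
  by rewrite !mulmxBl -!scalemxAl !mxtraceBE !mxtraceZ addrAC subrK subrK.
have eJ : \tr (pencil Q0 Q1 Q2 h *m Sh) =
    \tr (Q0 *m Sh) + h * \tr (Q1 *m Sh) + h ^+ 2 * \tr (Q2 *m Sh).
  by rewrite !mulmxDl -!scalemxAl !mxtraceD !mxtraceZ.
have eG1 : \tr (G1 *m Sh) = \tr (Q1 *m Sh) + \tr (cross P *m Sh).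
  by rewrite mulmxDl mxtraceD.
have eG2 : \tr (G2 *m Sh) = \tr (Q2 *m Sh) + \tr (E^T *m P *m E *m Sh).
  by rewrite mulmxDl mxtraceD.
have := defect PG G1 PGE; have := defect P Q0 PE; rewrite !trace_pencil eG1.
rewrite -(lyapunov_trace SE PE) -(lyapunov_trace SE PGE) -/G1 eJ.
have := b1P _ psdSh; have := b2P _ psdSh; have := b3P _ psdSh; rewrite eG2.
move: (\tr Sh) trSh => ts trSh.
have ms (b x : F) : 0 <= b -> `|x| <= b * ts -> `|x| <= b * s.
  by move=> b0 xb; apply: le_trans xb _; rewrite ler_wpM2l.
move=> /(ms _ _ b3_0) k3 /(ms _ _ b2_0) k2 /(ms _ _ b1_0) k1 e1 e2.
set lhs := (X in `|X|).
have -> : lhs = (\tr (P *m X2) + (\tr (Q2 *m Sh) + \tr (E^T *m P *m E *m Sh))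
    + \tr (PG *m X1) + h * \tr (PG *m X2) + \tr (cross PG *m Sh)
    + h * \tr (E^T *m PG *m E *m Sh)) * h ^+ 2.
  rewrite /lhs e1; move: e2; move: (\tr (Q1 *m Sh)) (\tr (cross P *m Sh)) => x y e2.
  have -> : x = \tr (G1 *m S) + h * \tr (PG *m X1) + h ^+ 2 * \tr (PG *m X2)
    + h * \tr (cross PG *m Sh) + h ^+ 2 * \tr (E^T *m PG *m E *m Sh) - y.
    by rewrite -e2 addrK.
  by ring.
rewrite normrM [`|h ^+ 2|]ger0_norm ?sqr_ge0 // ler_wpM2r ?sqr_ge0 //.
have hx x : `|h * x| <= `|x| by rewrite normrM ler_piMl.
do ![apply: le_trans (ler_normD _ _) _; apply: lerD => //].
by apply: le_trans (hx _) _.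
Qed.

End Perturbation.

Section DirectionalDerivative.
Variable F : realType.

Lemma derive_of_quadratic_error p q (f : 'M[F]_(p, q) -> F^o) X V (l d C : F) :
  0 < d -> (forall h, `|h| < d -> `|f (h *: V + X) - f X - h * l| <= C * h ^+ 2) ->
  'D_V f X = l.
Proof.
move=> d0 fP; rewrite /derive; apply/cvg_lim => //.
have C0 : 0 <= C.
  have := fP (d / 2); rewrite gtr0_norm ?divr_gt0 // ltr_pdivrMr // ltr_pMr // ltr1n.
  move=> /(_ isT) /(le_trans (normr_ge0 _)).
  by rewrite pmulr_lge0 // exprn_gt0 // divr_gt0.
apply/cvgrPdist_le => e e0; near=> h.
have h0 : h != 0 by near: h; apply: nbhs_dnbhs_neq.
have hd : `|h| < d by near: h; apply: dnbhs0_lt.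
have he : `|h| < e / (C + 1) by near: h; apply: dnbhs0_lt; rewrite divr_gt0 // ltr_wpDl.
have -> : l - h^-1 *: ((f \o shift X) (h *: V) - f X) =
    - (h^-1 * (f (h *: V + X) - f X - h * l)).
  by rewrite /= /GRing.scale /=; field.
rewrite normrN normrM normfV ler_pdivrMl ?normr_gt0 //.
apply: le_trans (fP h hd) _.
have -> : C * h ^+ 2 = `|h| * (C * `|h|).
  by rewrite -[h ^+ 2]ger0_norm ?sqr_ge0 // normrX; ring.
rewrite ler_wpM2l //; move: he; rewrite ltr_pdivlMr ?ltr_wpDl //.
by have := normr_ge0 h; lra.
Unshelve. all: by end_near.
Qed.

End DirectionalDerivative.

(** * Controller Gramians and the optimal cost *)

Section ClosedLoop.
Variables (F : realType) (n m d : nat).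

(** The closed loop as a function of the three blocks of the controller;
    transposition exchanges the roles of input and output ([tr_loop_mx]). *)
Definition loop_mx (A : 'M[F]_n) (B : 'M[F]_(n, m)) (C : 'M[F]_(d, n)) AK BK CK :
    'M[F]_(n + n) := block_mx A (B *m CK) (BK *m C) AK.

(** Besides the stage cost this is the second moment of the initial state, as
    [cost_mx X11 V BK^T]. *)
Definition cost_mx (Q : 'M[F]_n) (R : 'M[F]_m) (CK : 'M[F]_(m, n)) : 'M[F]_(n + n) :=
  block_mx Q 0 0 (CK^T *m R *m CK).

End ClosedLoop.

Section Gramians.
Variable F : realType.

Lemma sym_psd_block_diag n p (M : 'M[F]_n) (N : 'M[F]_p) :
  sym_psd M -> sym_psd N -> sym_psd (block_mx M 0 0 N).
Proof.
move=> [sM pM] [sN pN]; split=> [|v]; first by rewrite tr_block_mx !trmx0 sM sN.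
rewrite -[v]vsubmxK quad_form_block !mulmx0 !mul0mx !mx_entry0 !addr0.
exact: addr_ge0.
Qed.

(** If [P] vanishes at the state [(0, v)], the cost along the trajectory from there
    is zero.  As [R] is positive definite the input is zero, so the plant stays at
    rest while the controller runs freely with zero output.  Applied to the
    transposed closed loop, this is the statement for the covariance. *)
Lemma controller_gramian_pd n m d (A : 'M[F]_n) (B : 'M[F]_(n, m)) (C : 'M[F]_(d, n))
    AK BK CK Q R P :
  sym_psd Q -> sym_pd R -> sym_psd P ->
  P = cost_mx Q R CK + (loop_mx A B C AK BK CK)^T *m P *m loop_mx A B C AK BK CK ->
  (forall v : 'cV_n, (forall k, CK *m (AK ^+ k *m v) = 0) -> v = 0) ->
  sym_pd (drsubmx P).
Proof.
move=> psdQ pdR psdP PE obs; have [sP pP] := psdP.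
have psdD : sym_psd (cost_mx Q R CK).
  apply: sym_psd_block_diag psdQ _.
  exact/sym_psd_congr/sym_pd_psd.
have quad0 w : quad_form P (col_mx 0 w) = quad_form (drsubmx P) w.
  rewrite -[in LHS](submxK P) quad_form_block trmx0 !mulmx0 !mul0mx quad_formv0.
  by rewrite !mx_entry0 !add0r.
have step w : quad_form (drsubmx P) w = 0 ->
    CK *m w = 0 /\ quad_form (drsubmx P) (AK *m w) = 0.
  rewrite -quad0 {1}PE quad_formD quad_form_congr => /eqP.
  have [_ pD] := psdD; rewrite paddr_eq0 // => /andP[/eqP Dw /eqP Mw].
  have Cw : CK *m w = 0.
    move: Dw; rewrite quad_form_block quad_formv0 trmx0 !mulmx0 !mul0mx !mx_entry0 !add0r.
    rewrite quad_form_congr => RCw; apply/eqP/negPn/negP => nz.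
    by have [_ /(_ _ nz)] := pdR; rewrite RCw ltxx.
  split=> //; rewrite -quad0 -Mw /loop_mx mul_block_col !mulmx0 !add0r.
  by rewrite -mulmxA Cw mulmx0.
apply: sym_psd_pd.
  split=> [|w]; first by rewrite trmx_drsub sP.
  by rewrite -quad0.
move=> v v0; apply: obs => k.
suff: quad_form (drsubmx P) (AK ^+ k *m v) = 0 by move=> /step[].
elim: k => [|k /step[_ IHk]]; first by rewrite expr0 mul1mx.
by rewrite mulmxXS -mulmxA.
Qed.

Lemma tr_loop_mx n m d (A : 'M[F]_n) (B : 'M[F]_(n, m)) (C : 'M[F]_(d, n)) AK BK CK :
  (loop_mx A B C AK BK CK)^T = loop_mx A^T C^T B^T AK^T CK^T BK^T.
Proof. by rewrite /loop_mx tr_block_mx !trmx_mul. Qed.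

End Gramians.

Section Optimality.
Variables (F : realType) (n m d : nat).
Variables (A : 'M[F]_n) (B : 'M[F]_(n, m)) (C : 'M[F]_(d, n)).
Variables (Q X11 : 'M[F]_n) (R : 'M[F]_m) (V : 'M[F]_d).
Hypotheses (psdQ : sym_psd Q) (pdR : sym_pd R) (psdX : sym_psd X11) (pdV : sym_pd V).

Variables Ph Sh : 'M[F]_n.
Hypotheses (psdPh : sym_psd Ph) (PhE : Ph = riccati_map A B Q R Ph).
Hypotheses (psdSh : sym_psd Sh) (ShE : Sh = riccati_map A^T C^T X11 V Sh).

Let K := ctrl_gain A B R Ph.
Let L := filter_gain A C V Sh.

(** The cost under full information, plus the price of acting on an estimate of
    the state. *)
Definition optimal_cost :=
  \tr (Ph *m X11) + \tr ((R + B^T *m Ph *m B) *m (K *m Sh *m K^T)).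

Lemma filter_gain_dual : (ctrl_gain A^T C^T V Sh)^T = L.
Proof.
have [sS _] : sym_psd (C *m Sh *m C^T + V).
  by apply/sym_psdD; [apply: sym_psd_congrV|apply: sym_pd_psd].
have [sSh _] := psdSh.
rewrite /ctrl_gain /L /filter_gain trmxK addrC; mx_expand.
by rewrite trmx_inv sS sSh.
Qed.

Lemma innovation_unit : C *m Sh *m C^T + V \in unitmx.
Proof.
rewrite addrC -{1}[C]trmxK; apply/sym_pd_unit/sym_pdD => //.
exact: sym_psd_congr.
Qed.

Lemma filter_gainE : L *m (C *m Sh *m C^T + V) = A *m Sh *m C^T.
Proof. by rewrite /L /filter_gain mulmxKV // innovation_unit. Qed.

Variables (AK : 'M[F]_n) (BK : 'M[F]_(n, d)) (CK : 'M[F]_(m, n)).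
Let M := loop_mx A B C AK BK CK.
Hypothesis stM : power_stable M.
Variable S : 'M[F]_(n + n).
Hypothesis SE : S = cost_mx X11 V BK^T + M *m S *m M^T.

(** [riccati_square] for the block rows that read the plant state and the control
    off the closed-loop state. *)
Lemma cost_square : \tr (cost_mx Q R CK *m S) = \tr (Ph *m X11)
  + \tr ((R + B^T *m Ph *m B) *m (row_mx K CK *m S *m (row_mx K CK)^T)).
Proof.
pose a := row_mx A (B *m CK).
have S11 : row_mx 1%:M 0 *m S *m (row_mx 1%:M 0)^T = X11 + a *m S *m a^T.
  rewrite {1}SE mulmxDr mulmxDl; congr (_ + _).
    rewrite /cost_mx tr_row_mx mul_row_block mul_row_col trmx1 trmx0.
    by rewrite !mul1mx !mulmx1 !mulmx0 !addr0.
  have -> : row_mx 1%:M 0 *m (M *m S *m M^T) *m (row_mx 1%:M 0)^T =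
    (row_mx 1%:M 0 *m M) *m S *m (row_mx 1%:M 0 *m M)^T by rewrite trmx_mul !mulmxA.
  by rewrite /M /loop_mx mul_row_block !mul1mx !mul0mx !addr0.
have := riccati_square A B Q (pdR) (row_mx 1%:M 0) (row_mx 0 CK) psdPh.
have -> : A *m row_mx 1%:M 0 + B *m row_mx 0 CK = a.
  by rewrite !mul_mx_row add_row_mx mulmx1 !mulmx0 addr0 add0r.
have -> : row_mx 0 CK + ctrl_gain A B R Ph *m row_mx 1%:M 0 = row_mx K CK.
  by rewrite mul_mx_row add_row_mx mulmx1 mulmx0 addr0 add0r.
rewrite -PhE.
have -> : (row_mx 1%:M 0)^T *m Q *m row_mx 1%:M 0 + (row_mx 0 CK)^T *m R *m row_mx 0 CK
    = cost_mx Q R CK.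
  rewrite !tr_row_mx !mul_col_mx !mul_mx_row -!block_mxEv.
  rewrite trmx1 !trmx0 !mul1mx !mulmx1 !mulmx0 !mul0mx.
  by rewrite add_block_mx !addr0 !add0r.
move=> /(congr1 (fun Z => \tr (Z *m S))) e.
have trc p (Z : 'M[F]_p) (Y : 'M[F]_(p, n + n)) : \tr (Y^T *m Z *m Y *m S) =
    \tr (Z *m (Y *m S *m Y^T)).
  by rewrite -!mulmxA mxtrace_mulC !mulmxA.
rewrite 2!mulmxDl 2!mxtraceD !trc S11 mulmxDr mxtraceD in e.
by apply: (addIr (\tr (Ph *m (a *m S *m a^T)))); rewrite e addrAC.
Qed.

(** No controller knows the state better than the filter.  The difference solves
    the Lyapunov equation of the closed loop with source
    [Z (C Sh C^T + V) Z^T], where [Z] stacks [L] and [BK]. *)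
Lemma covariance_excess_psd : sym_psd (S - block_mx Sh 0 0 0).
Proof.
have psdW : sym_psd (C *m Sh *m C^T + V).
  by apply/sym_psdD; [apply: sym_psd_congrV|apply: sym_pd_psd].
apply: (lyapunov_psd stM (sym_psd_congrV (col_mx L BK) psdW)).
have ShE' : X11 - Sh + A *m Sh *m A^T = L *m (C *m Sh *m C^T + V) *m L^T.
  have [sSh _] := psdSh; have [sW _] := psdW.
  rewrite filter_gainE /L /filter_gain !trmx_mul trmxK trmx_inv sW sSh.
  rewrite {1}ShE /riccati_map !trmxK !mulmxA [V + _]addrC.
  by mx_abel.
have sL : C *m Sh *m A^T = (C *m Sh *m C^T + V) *m L^T.
  have [sSh _] := psdSh; have [sW _] := psdW.
  by rewrite -[X in _ = X *m _]sW -trmx_mul filter_gainE !trmx_mul trmxK sSh mulmxA.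
have -> : col_mx L BK *m (C *m Sh *m C^T + V) *m (col_mx L BK)^T =
    cost_mx X11 V BK^T - block_mx Sh 0 0 0 + M *m block_mx Sh 0 0 0 *m M^T.
  have -> : M *m block_mx Sh 0 0 0 *m M^T = block_mx (A *m Sh *m A^T)
      (A *m Sh *m C^T *m BK^T) (BK *m (C *m Sh *m A^T)) (BK *m C *m Sh *m C^T *m BK^T).
    rewrite /M /loop_mx tr_block_mx !mulmx_block !mulmx0 !addr0 !mul0mx !addr0.
    by rewrite !trmx_mul !mulmxA.
  rewrite tr_col_mx !mul_col_mx !mul_mx_row -!block_mxEv -ShE' filter_gainE sL.
  rewrite /cost_mx opp_block_mx !add_block_mx trmxK !oppr0 !addr0 !add0r.
  by congr block_mx; mx_expand; mx_abel.
by rewrite {1}SE; mx_expand; mx_abel.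
Qed.

Lemma optimal_cost_le : optimal_cost <= \tr (cost_mx Q R CK *m S).
Proof.
rewrite cost_square /optimal_cost lerD2l -subr_ge0 -[X in 0 <= X]mxtraceBE -mulmxBr.
have -> : K *m Sh *m K^T = row_mx K CK *m block_mx Sh 0 0 0 *m (row_mx K CK)^T.
  by rewrite mul_row_block tr_row_mx mul_row_col !mulmx0 !addr0 mul0mx addr0.
rewrite -mulmxBl -mulmxBr; apply: psd_trace_ge0.
  by have [] := sym_pd_psd (riccati_weight_pd B pdR psdPh).
exact: sym_psd_congrV covariance_excess_psd.
Qed.

Lemma optimal_cost_attained G : CK = - K *m G ->
  Sh = row_mx 1%:M (- G) *m S *m (row_mx 1%:M (- G))^T ->
  \tr (cost_mx Q R CK *m S) = optimal_cost.
Proof.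
move=> CKE ShS; rewrite cost_square /optimal_cost; congr (_ + \tr (_ *m _)).
have -> : row_mx K CK = K *m row_mx 1%:M (- G).
  by rewrite mul_mx_row mulmx1 CKE mulNmx mulmxN.
by rewrite trmx_mul [in RHS]ShS !mulmxA.
Qed.

End Optimality.

(** * The structure of minimal stationary points *)

Section Stationarity.
Variables (F : realType) (n m d : nat).
Variables (A : 'M[F]_n) (B : 'M[F]_(n, m)) (C : 'M[F]_(d, n)).
Variables (Q X11 : 'M[F]_n) (R : 'M[F]_m) (V : 'M[F]_d).
Hypotheses (psdQ : sym_psd Q) (pdR : sym_pd R) (psdX : sym_psd X11) (pdV : sym_pd V).
Variables (AK : 'M[F]_n) (BK : 'M[F]_(n, d)) (CK : 'M[F]_(m, n)).
Let M := loop_mx A B C AK BK CK.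
Variables P S : 'M[F]_(n + n).
Hypothesis PE : P = cost_mx Q R CK + M^T *m P *m M.
Hypothesis SE : S = cost_mx X11 V BK^T + M *m S *m M^T.
Hypotheses (psdP : sym_psd P) (psdS : sym_psd S).
Hypotheses (pdP22 : sym_pd (drsubmx P)) (pdS22 : sym_pd (drsubmx S)).

Let W := P *m M *m S.
Hypothesis gradA0 : drsubmx W = 0.
Hypothesis gradB0 : dlsubmx W *m C^T + drsubmx P *m BK *m V = 0.
Hypothesis gradC0 : B^T *m ursubmx W + R *m CK *m drsubmx S = 0.

(** The matrix [T] sends a plant state to the controller state of least cost, and
    [G] in the proof sends a controller state to the best linear estimate of the
    plant state.  The heart of the matter is that stationarity makes them inverse
    to each other. *)
Lemma stationary_structure : exists Ph Sh T : 'M[F]_n,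
  [/\ sym_psd Ph, Ph = riccati_map A B Q R Ph, sym_psd Sh,
      Sh = riccati_map A^T C^T X11 V Sh &
   [/\ T \in unitmx, BK = T *m filter_gain A C V Sh,
      CK = - ctrl_gain A B R Ph *m invmx T,
      AK = T *m (A - B *m ctrl_gain A B R Ph - filter_gain A C V Sh *m C) *m invmx T &
      Sh = row_mx 1%:M (- invmx T) *m S *m (row_mx 1%:M (- invmx T))^T]].
Proof.
have uP := sym_pd_unit pdP22; have uS := sym_pd_unit pdS22.
have [sP _] := psdP; have [sS _] := psdS.
set P11 := ulsubmx P; set P12 := ursubmx P; set P22 := drsubmx P in uP *.
set S11 := ulsubmx S; set S12 := ursubmx S; set S22 := drsubmx S in uS *.
have defP : P = block_mx P11 P12 P12^T P22.
  by rewrite -[LHS]submxK -[in dlsubmx P]sP -trmx_ursub.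
have defS : S = block_mx S11 S12 S12^T S22.
  by rewrite -[LHS]submxK -[in dlsubmx S]sS -trmx_ursub.
have sP22 : P22^T = P22 by rewrite trmx_drsub sP.
have sS22 : S22^T = S22 by rewrite trmx_drsub sS.
have sS11 : S11^T = S11 by rewrite trmx_ulsub sS.
pose T := - (invmx P22 *m P12^T); pose G := S12 *m invmx S22.
have P21E : P12^T = - (P22 *m T) by rewrite /T mulmxN opprK mulKVmx.
have S12E : S12 = G *m S22 by rewrite /G mulmxKV.
have S21E : S12^T = S22 *m G^T by rewrite {1}S12E trmx_mul sS22.
pose Ph := (col_mx 1%:M T)^T *m P *m col_mx 1%:M T.
pose Sh := row_mx 1%:M (- G) *m S *m (row_mx 1%:M (- G))^T.
have psdPh : sym_psd Ph by apply: sym_psd_congr.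
have psdSh : sym_psd Sh by apply: sym_psd_congrV.
have PhE : Ph = P11 + P12 *m T.
  rewrite /Ph {1}defP tr_col_mx mul_row_block mul_row_col trmx1 !mul1mx mulmx1.
  by rewrite P21E; mx_expand; mx_abel.
have ShE : Sh = S11 - G *m S12^T.
  rewrite /Sh {1}defS tr_row_mx mul_row_block mul_row_col trmx1 !mul1mx mulmx1.
  by rewrite {2}S12E; mx_expand; mx_abel.
pose D := BK *m C - T *m A; pose E := AK - T *m (B *m CK).
have WE : W = block_mx
    (P11 *m (A *m S11 + B *m CK *m S12^T) + P12 *m (BK *m C *m S11 + AK *m S12^T))
    (P11 *m (A *m S12 + B *m CK *m S22) + P12 *m (BK *m C *m S12 + AK *m S22))
    (P22 *m (D *m S11 + E *m S12^T)) (P22 *m (D *m S12 + E *m S22)).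
  rewrite /W defP [in LHS]defS /M /loop_mx -mulmxA !mulmx_block P21E.
  by congr block_mx; rewrite /D /E; mx_expand; mx_abel.
(* The gradient in [AK] kills the right block of [row_mx D E *m S]. *)
have EE : E = - (D *m G).
  have := gradA0; rewrite WE block_mxKdr => /(congr1 (mulmx (invmx P22))).
  rewrite mulKmx // mulmx0 S12E mulmxA -mulmxDl => /(congr1 (mulmxr (invmx S22))).
  by rewrite /= mulmxK // mul0mx addrC => /eqP; rewrite addr_eq0 => /eqP.
(* The left block is then [D *m Sh], and the gradient in [BK] determines [BK]. *)
have BE : D *m Sh *m C^T + BK *m V = 0.
  have := gradB0; rewrite WE block_mxKdl -[P22 *m _ *m C^T]mulmxA -[P22 *m BK *m V]mulmxA -mulmxDr.
  move=> /(congr1 (mulmx (invmx P22))); rewrite mulKmx // mulmx0 => <-.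
  by rewrite EE ShE; mx_expand; mx_abel.
have uW : C *m Sh *m C^T + V \in unitmx by apply: innovation_unit.
have BKE : BK = T *m filter_gain A C V Sh.
  have : BK *m (C *m Sh *m C^T + V) = T *m A *m Sh *m C^T.
    apply/eqP; rewrite -subr_eq0 -BE /D; apply/eqP; by mx_expand; mx_abel.
  move=> e; rewrite /filter_gain; move: uW e; move: (Sh) => Z uZ e.
  by rewrite !mulmxA -e mulmxK.
(* Multiply the Lyapunov equation of [S] by [row_mx (- T) 1%:M] on the left and
   keep the right block: its right-hand side becomes the left-hand side of [BE]
   times [BK^T], that is zero. *)
have S22E : S22 - T *m S12 = 0.
  have eS : row_mx (- T) 1%:M *m S *m (row_mx 0 1%:M)^T = S22 - T *m S12.
    rewrite {1}defS mul_row_block tr_row_mx mul_row_col trmx0 trmx1.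
    by rewrite mulmx0 add0r mulmx1 mul1mx addrC mulNmx.
  rewrite -eS {1}SE mulmxDr mulmxDl.
  have -> : row_mx (- T) 1%:M *m cost_mx X11 V BK^T *m (row_mx 0 1%:M)^T = BK *m V *m BK^T.
    rewrite /cost_mx mul_row_block tr_row_mx mul_row_col trmx0 trmx1 trmxK.
    by rewrite !mulmx0 add0r add0r !mulmx1 mul1mx.
  have -> : row_mx (- T) 1%:M *m (M *m S *m M^T) *m (row_mx 0 1%:M)^T =
      row_mx (- T) 1%:M *m M *m S *m (row_mx 0 1%:M *m M)^T.
    by rewrite trmx_mul !mulmxA.
  have -> : row_mx (- T) 1%:M *m M = row_mx D E.
    rewrite /M /loop_mx mul_row_block /D /E; congr row_mx; mx_expand; mx_abel.
  have -> : row_mx 0 1%:M *m M = row_mx (BK *m C) AK.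
    by rewrite /M /loop_mx mul_row_block !mul0mx !mul1mx !add0r.
  have -> : row_mx D E *m S = row_mx (D *m Sh) 0.
    rewrite {1}defS mul_row_block EE ShE; congr row_mx; first by mx_expand; mx_abel.
    by rewrite {1}S12E; mx_expand; mx_abel.
  rewrite tr_row_mx mul_row_col mul0mx addr0 trmx_mul.
  have := congr1 (mulmxr BK^T) BE; rewrite /= mul0mx => <-.
  by mx_expand; mx_abel.
have TG : T *m G = 1%:M.
  move/subr0_eq: S22E; rewrite S12E mulmxA => e.
  by rewrite -[LHS](mulmxK uS) -e mulmxV.
have [uT uG] := mulmx1_unit TG.
have GE : G = invmx T by rewrite -[LHS]mul1mx -(mulVmx uT) -mulmxA TG mulmx1.
have GT : G *m T = 1%:M by rewrite GE mulVmx.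
have CKE : CK = - ctrl_gain A B R Ph *m G.
  have e : AK = T *m (A *m G + B *m CK) - BK *m C *m G.
    by move: EE; rewrite /E /D => /eqP; rewrite subr_eq => /eqP ->; mx_expand; mx_abel.
  have gC : B^T *m (Ph *m (A *m G + B *m CK)) + R *m CK = 0.
    have := congr1 (mulmxr (invmx S22)) gradC0; rewrite WE block_mxKur /= mul0mx.
    have -> : P11 *m (A *m S12 + B *m CK *m S22) + P12 *m (BK *m C *m S12 + AK *m S22) =
        Ph *m (A *m G + B *m CK) *m S22.
      by rewrite PhE S12E {1}e; mx_expand; mx_abel.
    by rewrite (mulmxA B^T _ S22) -mulmxDl mulmxK.
  have : (R + B^T *m Ph *m B) *m CK = - (B^T *m Ph *m A *m G).
    by apply/eqP; rewrite -addr_eq0 -gC; apply/eqP; mx_expand; mx_abel.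
  move=> /(congr1 (mulmx (invmx (R + B^T *m Ph *m B)))).
  rewrite mulKmx; last exact/sym_pd_unit/riccati_weight_pd.
  by move=> ->; rewrite /ctrl_gain mulmxN mulNmx !mulmxA.
have AKE : AK = T *m (A - B *m ctrl_gain A B R Ph - filter_gain A C V Sh *m C) *m G.
  by move: EE; rewrite /E /D => /eqP; rewrite subr_eq => /eqP ->;
    rewrite {1}BKE CKE; mx_expand; mx_abel.
exists Ph, Sh, T; rewrite -GE; split=> //.
- rewrite riccati_map_closed_loop // {1}/Ph {1}PE mulmxDr mulmxDl.
  set K := ctrl_gain _ _ _ _ in CKE AKE *; congr (_ + _).
    rewrite /cost_mx tr_col_mx mul_row_block mul_row_col trmx1 !mul1mx !mulmx1 !mulmx0.
    rewrite !addr0 !add0r CKE; congr (_ + _).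
    have -> : T^T *m ((- K *m G)^T *m R *m (- K *m G)) *m T =
      (K *m (G *m T))^T *m R *m (K *m (G *m T)) by mx_expand; mx_abel.
    by rewrite GT mulmx1.
  (* The graph of [T] is invariant, and the closed loop acts there as the
     regulator. *)
  have MJ : M *m col_mx 1%:M T = col_mx 1%:M T *m (A - B *m K).
    rewrite /M /loop_mx mul_block_col mul_col_mx mul1mx !mulmx1 CKE AKE BKE.
    rewrite -[_ *m G *m T]mulmxA GT mulmx1; congr col_mx.
      have -> : B *m (- K *m G) *m T = - (B *m K *m (G *m T)) by mx_expand.
      by rewrite GT mulmx1.
    by mx_expand; mx_abel.
  have -> : (col_mx 1%:M T)^T *m (M^T *m P *m M) *m col_mx 1%:M T =
    (M *m col_mx 1%:M T)^T *m P *m (M *m col_mx 1%:M T) by rewrite trmx_mul !mulmxA.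
  by rewrite MJ trmx_mul /Ph !mulmxA.
- rewrite riccati_map_closed_loop // -[ctrl_gain _ _ _ _]trmxK filter_gain_dual //.
  set L := filter_gain _ _ _ _ in BKE AKE *; set K := ctrl_gain _ _ _ _ in CKE AKE *.
  rewrite {1}/Sh {1}SE mulmxDr mulmxDl !trmxK; congr (_ + _).
    rewrite /cost_mx tr_row_mx mul_row_block mul_row_col trmx1 !mul1mx !mulmx1 !mulmx0.
    rewrite !addr0 !add0r BKE trmxK; congr (_ + _).
    have -> : - G *m (T *m L *m V *m (T *m L)^T) *m (- G)^T =
      (G *m T) *m L *m V *m ((G *m T) *m L)^T by mx_expand; mx_abel.
    by rewrite GT mul1mx.
  (* The estimation error evolves by itself, as in the filter. *)
  have HM : row_mx 1%:M (- G) *m M = (A - L *m C) *m row_mx 1%:M (- G).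
    rewrite /M /loop_mx mul_row_block mul_mx_row mul1mx !mulmx1 CKE AKE BKE.
    have -> : - G *m (T *m L *m C) = - (G *m T) *m (L *m C) by mx_expand; mx_abel.
    have -> : - G *m (T *m (A - B *m K - L *m C) *m G) =
      - (G *m T) *m (A - B *m K - L *m C) *m G by mx_expand; mx_abel.
    by rewrite GT; congr row_mx; mx_expand; mx_abel.
  have -> : row_mx 1%:M (- G) *m (M *m S *m M^T) *m (row_mx 1%:M (- G))^T =
    (row_mx 1%:M (- G) *m M) *m S *m (row_mx 1%:M (- G) *m M)^T by rewrite trmx_mul !mulmxA.
  have -> : (A^T - C^T *m L^T)^T = A - L *m C by mx_expand.
  have -> : A^T - C^T *m L^T = (A - L *m C)^T by mx_expand.
  by rewrite HM trmx_mul /Sh !mulmxA.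
Qed.

End Stationarity.

(** * Second moments and the expected cost *)

Section Moments.
Context {dO : measure_display} {Omega : measurableType dO} {F : realType}.
Variable Pr : probability Omega F.

(** By uniqueness of product measures the joint law of [X] and [Y] is the product
    of their laws, and Fubini integrates [Y] first. *)
Lemma expectation_independentM (X Y : {RV Pr >-> F}) :
  (forall U V, measurable U -> measurable V ->
    Pr (X @^-1` U `&` Y @^-1` V) = (Pr (X @^-1` U) * Pr (Y @^-1` V))%E) ->
  (X : Omega -> F) \* Y \in Lfun Pr 1 -> (Y : Omega -> F) \in Lfun Pr 1 ->
  ('E_Pr[Y] = 0)%E -> ('E_Pr[(X : Omega -> F) \* Y] = 0)%E.
Proof.
move=> indep intXY intY EY0.
pose Z w := (X w, Y w).
have mZ : measurable_fun setT Z by apply: measurable_fun_pair.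
pose Zm : {mfun Omega >-> (F * F)%type} :=
  HB.pack Z (isMeasurableFun.Build _ _ _ _ Z mZ).
pose m1 := distribution Pr X; pose m2 := distribution Pr Y.
have jointE S : measurable S -> (m1 \x m2)%E S = distribution Pr Zm S.
  apply: product_measure_unique => U V mU mV.
  by rewrite /m1 /m2 /distribution /pushforward /= -indep.
pose f (z : F * F) := (z.1 * z.2)%:E.
have mf : measurable_fun [set: (F * F)%type] f.
  by apply/measurable_EFinP; apply: measurable_funM;
    [apply: measurable_fst|apply: measurable_snd].
have intfZ : Pr.-integrable setT (f \o Zm).
  by move/Lfun1_integrable: intXY.
have intf : (m1 \x m2)%E.-integrable setT f.
  have /integrableP[_ foo] := integrable_pushforward mZ mf intfZ measurableT.
  apply/integrableP; split=> //.
  rewrite (eq_measure_integral (distribution Pr Zm)) //.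
  by move=> S mS _; apply: jointE.
have EY : (\int[m2]_y y%:E = 0)%E.
  rewrite integral_distribution //; last exact/Lfun1_integrable.
  by rewrite -EY0 unlock.
rewrite unlock -[LHS](integral_distribution (X := Zm) (f := f)) //.
rewrite (eq_measure_integral (m1 \x m2)%E); last first.
  by move=> S mS _; apply/esym/jointE.
rewrite -integral12_prod_meas1 // -[RHS](integral0 m1 setT).
apply: eq_integral => x _; rewrite /fubini_F /f /=.
under eq_integral do rewrite EFinM.
rewrite integralZl // ?EY ?mule0 //.
apply: integrable_pushforward => //.
exact/Lfun1_integrable.
Qed.


Lemma quad_form_rvec n (N : 'M[F]_n) (y : 'I_n -> {RV Pr >-> F}) w :
  quad_form N (rvec y w) = \sum_i \sum_j N i j * (y i w * y j w).
Proof.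
rewrite quad_form_entries; apply: eq_bigr => i _.
by apply: eq_bigr => j _; rewrite !mxE.
Qed.

Lemma measurable_quad_form n (N : 'M[F]_n) (y : 'I_n -> {RV Pr >-> F}) :
  measurable_fun setT (fun w => quad_form N (rvec y w)).
Proof.
under eq_fun do rewrite quad_form_rvec.
apply: measurable_sum => i; apply: measurable_sum => j.
by apply: measurable_realfun.measurable_funM => //;
  apply: measurable_realfun.measurable_funM.
Qed.

Lemma expectation_quad_form n (N : 'M[F]_n) (y : 'I_n -> {RV Pr >-> F}) :
  square_integrable y ->
  (\int[Pr]_w (quad_form N (rvec y w))%:E = (\tr (N *m second_moment y))%:E)%E.
Proof.
move=> L2y.
have L1 i j : (fun w => y i w * y j w) \in Lfun Pr 1.
  exact: Lfun2_mul_Lfun1 (L2y i) (L2y j).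
have -> : (fun w => (quad_form N (rvec y w))%:E) =
    (fun w => \sum_i \sum_j (N i j)%:E * (y i w * y j w)%:E)%E.
  apply/funext => w; rewrite quad_form_rvec -sumEFin; apply: eq_bigr => i _.
  by rewrite -sumEFin.
have intij i j : Pr.-integrable setT (fun w => (N i j)%:E * (y i w * y j w)%:E)%E.
  by apply: integrableZl => //; apply/Lfun1_integrable/L1.
rewrite integral_sum //; last by move=> i; apply: integrable_sum.
under eq_bigr do rewrite integral_sum //.
rewrite /mxtrace -sumEFin; apply: eq_bigr => i _; rewrite mxE -sumEFin.
apply: eq_bigr => j _; rewrite integralZl //; last exact/Lfun1_integrable/L1.
rewrite mxE EFinM fineK ?expectation_fin_num //.
by rewrite unlock; congr (_ * _)%E; apply: eq_integral => w _; rewrite mulrC.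
Qed.

Lemma second_moment_psd n (y : 'I_n -> {RV Pr >-> F}) :
  square_integrable y -> sym_psd (second_moment y).
Proof.
move=> L2y; split=> [|v].
  apply/matrixP => i j; rewrite !mxE; congr (fine 'E_Pr[_]).
  by apply/funext => w; rewrite mulrC.
rewrite quad_form_tr mxtrace_mulC -lee_fin -expectation_quad_form //.
apply: integral_ge0 => w _; rewrite lee_fin.
have -> : v *m v^T = v^T^T *m 1%:M *m v^T by rewrite trmxK mulmx1.
by rewrite quad_form_congr; apply: sqnorm_ge0.
Qed.

Definition rv_cat n p (X : 'I_n -> {RV Pr >-> F}) (Y : 'I_p -> {RV Pr >-> F})
    (i : 'I_(n + p)) : {RV Pr >-> F} :=
  match fintype.split i with inl j => X j | inr j => Y j end.

Lemma rvec_cat n p (X : 'I_n -> {RV Pr >-> F}) (Y : 'I_p -> {RV Pr >-> F}) w :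
  rvec (rv_cat X Y) w = col_mx (rvec X w) (rvec Y w).
Proof. by apply/colP => i; rewrite !mxE /rv_cat; case: fintype.split => j; rewrite mxE. Qed.

Lemma square_integrable_cat n p (X : 'I_n -> {RV Pr >-> F}) (Y : 'I_p -> {RV Pr >-> F}) :
  square_integrable X -> square_integrable Y -> square_integrable (rv_cat X Y).
Proof. by move=> LX LY i; rewrite /rv_cat; case: fintype.split. Qed.

(** The off-diagonal blocks vanish by independence, as [Y] has zero mean. *)
Lemma second_moment_cat n p (X : 'I_n -> {RV Pr >-> F}) (Y : 'I_p -> {RV Pr >-> F}) :
  square_integrable X -> square_integrable Y -> zero_mean Y -> independent X Y ->
  second_moment (rv_cat X Y) = block_mx (second_moment X) 0 0 (second_moment Y).
Proof.
move=> LX LY EY0 indep.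
have cross0 i j : ('E_Pr[(fun w => (X i w * Y j w)%R)] = 0)%E.
  apply: expectation_independentM (EY0 j) => [U V mU mV||].
  - by apply: indep; apply: sub_gen_smallest; [exists i, U|exists j, V].
  - exact: Lfun2_mul_Lfun1 (LX i) (LY j).
  - apply: Lfun_subset12 (LY j).
    by rewrite fin_num_measure.
rewrite -[LHS]submxK; congr block_mx; apply/matrixP => i j;
  rewrite !mxE /rv_cat ?(unsplitK (inl _)) ?(unsplitK (inr _)) //.
- by rewrite cross0.
- rewrite (_ : (fun w => _) = fun w => X j w * Y i w) ?cross0 //.
  by apply/funext => w; rewrite mulrC.
Qed.

End Moments.

Section Cost.
Context {dO : measure_display} {Omega : measurableType dO} {F : realType}.
Variable Pr : probability Omega F.
Variables (n m d : nat).
Variables (A : 'M[F]_n) (B : 'M[F]_(n, m)) (C : 'M[F]_(d, n)).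
Variables (Q : 'M[F]_n) (R : 'M[F]_m).
Variables (x0 : 'I_n -> {RV Pr >-> F}) (s : 'I_d -> {RV Pr >-> F}).
Hypotheses (psdQ : sym_psd Q) (pdR : sym_pd R).
Hypotheses (L2x0 : square_integrable x0) (L2s : square_integrable s).
Hypotheses (Es0 : zero_mean s) (indep : independent x0 s).
Implicit Types K : 'M[F]_(m + n, d + n).

Lemma trajectoryE K x z t : col_mx (trajectory A B C K x z t).1 (trajectory A B C K x z t).2 =
  closed_loop_mx A B C K ^+ t *m col_mx x (ctrlB K *m z).
Proof.
elim: t => [|t IHt]; first by rewrite expr0 mul1mx.
rewrite mulmxXS -mulmxA -IHt /=; case: (trajectory _ _ _ _ _ _ t) => y xi /=.
by rewrite mul_block_col !mulmxA [ctrlA K *m xi + _]addrC.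
Qed.

Lemma stage_costE K x z t : stage_cost A B C Q R K x z t =
  quad_form (cost_mx Q R (ctrlC K))
    (closed_loop_mx A B C K ^+ t *m block_mx 1%:M 0 0 (ctrlB K) *m col_mx x z).
Proof.
rewrite -mulmxA mul_block_col !mul0mx addr0 add0r mul1mx -trajectoryE /stage_cost.
case: trajectory => y xi /=.
by rewrite quad_form_block !mulmx0 !mul0mx !mx_entry0 !addr0 quad_form_congr.
Qed.

Lemma cost_mx_psd (CK : 'M[F]_(m, n)) : sym_psd (cost_mx Q R CK).
Proof. exact/(sym_psd_block_diag psdQ)/sym_psd_congr/sym_pd_psd. Qed.

(** The stage costs are nonnegative, so expectation and sum commute even where the
    cost is infinite. *)
Lemma cost_series K : cost A B C Q R x0 s K =
  (\sum_(0 <= t <oo) (\tr (cost_mx Q R (ctrlC K) *m (closed_loop_mx A B C K ^+ t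
    *m cost_mx (second_moment x0) (second_moment s) (ctrlB K)^T
    *m (closed_loop_mx A B C K ^+ t)^T)))%:E)%E.
Proof.
set M := closed_loop_mx A B C K; pose D : 'M[F]_(n + n, n + d) := block_mx 1%:M 0 0 (ctrlB K).
pose y := rv_cat x0 s.
have stageE w t : stage_cost A B C Q R K (rvec x0 w) (rvec s w) t =
    quad_form ((M ^+ t *m D)^T *m cost_mx Q R (ctrlC K) *m (M ^+ t *m D)) (rvec y w).
  by rewrite stage_costE quad_form_congr rvec_cat.
have L2y := square_integrable_cat L2x0 L2s.
rewrite /cost integral_nneseries //; last first.
- move=> t w _; rewrite lee_fin stageE quad_form_congr.
  by have [_] := cost_mx_psd (ctrlC K); apply.
- move=> t; apply/measurable_EFinP; under eq_fun do rewrite stageE.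
  exact: measurable_quad_form.
apply: eq_eseriesr => t _; under eq_integral do rewrite stageE.
rewrite expectation_quad_form // second_moment_cat //; congr EFin.
rewrite -!mulmxA mxtrace_mulC !mulmxA; congr (\tr _).
rewrite -!mulmxA; congr (_ *m (_ *m _)); rewrite trmx_mul !mulmxA; congr (_ *m _).
rewrite /D /cost_mx tr_block_mx !mulmx_block !trmx0 trmx1 trmxK.
by rewrite ?(mul1mx, mulmx1, mulmx0, mul0mx, addr0, add0r).
Qed.

Lemma cost_stable K S : power_stable (closed_loop_mx A B C K) ->
  S = cost_mx (second_moment x0) (second_moment s) (ctrlB K)^T
      + closed_loop_mx A B C K *m S *m (closed_loop_mx A B C K)^T ->
  cost A B C Q R x0 s K = (\tr (cost_mx Q R (ctrlC K) *m S))%:E.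
Proof.
set M := closed_loop_mx A B C K => stM SE; rewrite cost_series -/M.
set X := cost_mx _ _ (ctrlB K)^T; set QC := cost_mx Q R _.
apply/cvg_lim => //.
have -> : (fun N => \sum_(0 <= t < N) (\tr (QC *m (M ^+ t *m X *m (M ^+ t)^T)))%:E)%E =
    (fun N => (\tr (QC *m S) - \tr (QC *m (M ^+ N *m S *m (M ^+ N)^T)))%:E).
  apply/funext => N; rewrite sumEFin big_mkord; congr EFin.
  rewrite -raddf_sum -mulmx_sumr -mxtraceBE -mulmxBr.
  congr (\tr (_ *m _)); apply/esym/eqP; rewrite subr_eq; apply/eqP.
  exact: lyapunov_iter.
apply: cvg_EFin; first by apply: nearW.
rewrite -[X in _ --> X]subr0; apply: cvgB; first exact: cvg_cst.
rewrite -[X in _ --> X](mxtrace0 F (n + n)) -[X in \tr X](mulmx0 _ QC).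
apply: cvg_mxtrace; apply: mcvgM; first exact: mcvg_cst.
rewrite -[X in mcvg _ X](mul0mx _ (0 : 'M[F]_(n + n))).
apply: mcvgM; last by rewrite -[X in mcvg _ X]trmx0; apply: mcvg_tr.
by rewrite -[X in mcvg _ X](mul0mx _ S); apply: mcvgM => //; apply: mcvg_cst.
Qed.

End Cost.


(** * The gradient equations *)

Section GradientEquations.
Context {dO : measure_display} {Omega : measurableType dO} {F : realType}.
Variable Pr : probability Omega F.
Variables (n m d : nat).
Variables (A : 'M[F]_n) (B : 'M[F]_(n, m)) (C : 'M[F]_(d, n)).
Variables (Q : 'M[F]_n) (R : 'M[F]_m).
Variables (x0 : 'I_n -> {RV Pr >-> F}) (s : 'I_d -> {RV Pr >-> F}).
Hypotheses (psdQ : sym_psd Q) (pdR : sym_pd R).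
Hypotheses (L2x0 : square_integrable x0) (L2s : square_integrable s).
Hypotheses (Es0 : zero_mean s) (indep : independent x0 s).
Let X11 := second_moment x0.
Let V := second_moment s.
Hypotheses (psdX : sym_psd X11) (pdV : sym_pd V).

Let cost_of AK BK CK := fine (cost A B C Q R x0 s (ctrl_mx AK BK CK)).

Lemma ctrl_mxK (AK : 'M[F]_n) (BK : 'M[F]_(n, d)) (CK : 'M[F]_(m, n)) :
  [/\ ctrlA (ctrl_mx AK BK CK) = AK, ctrlB (ctrl_mx AK BK CK) = BK
    & ctrlC (ctrl_mx AK BK CK) = CK].
Proof. by rewrite /ctrlA /ctrlB /ctrlC /ctrl_mx block_mxKdr block_mxKdl block_mxKur. Qed.

Lemma closed_loop_ctrl_mx AK BK CK :
  closed_loop_mx A B C (ctrl_mx AK BK CK) = loop_mx A B C AK BK CK.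
Proof. by rewrite /closed_loop_mx; have [-> -> ->] := ctrl_mxK AK BK CK. Qed.

Lemma cost_of_stable AK BK CK S : power_stable (loop_mx A B C AK BK CK) ->
  S = cost_mx X11 V BK^T
      + loop_mx A B C AK BK CK *m S *m (loop_mx A B C AK BK CK)^T ->
  cost A B C Q R x0 s (ctrl_mx AK BK CK) = (\tr (cost_mx Q R CK *m S))%:E.
Proof.
have [_ eB eC] := ctrl_mxK AK BK CK; rewrite -closed_loop_ctrl_mx => st SE.
rewrite -[in BK^T]eB in SE.
by rewrite (cost_stable psdQ pdR L2x0 L2s Es0 indep st SE) eC.
Qed.

Lemma cost_mx_pencil p q (Q' : 'M[F]_p) (R' : 'M[F]_q) (CK dC : 'M[F]_(q, p)) h :
  cost_mx Q' R' (h *: dC + CK) = pencil (cost_mx Q' R' CK)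
    (block_mx 0 0 0 (dC^T *m R' *m CK + CK^T *m R' *m dC))
    (block_mx 0 0 0 (dC^T *m R' *m dC)) h.
Proof.
rewrite /pencil /cost_mx !scale_block_mx !add_block_mx !scaler0 !addr0; congr block_mx.
mx_expand; rewrite -?(scalemxAl, scalemxAr) !scalerDr expr2 -scalerA; mx_abel.
Qed.

Section Direction.
Variables (AK dA : 'M[F]_n) (BK dB : 'M[F]_(n, d)) (CK dC : 'M[F]_(m, n)).
Let M := loop_mx A B C AK BK CK.
Hypothesis stM : power_stable M.
Variables P S : 'M[F]_(n + n).
Hypothesis PE : P = cost_mx Q R CK + M^T *m P *m M.
Hypothesis SE : S = cost_mx X11 V BK^T + M *m S *m M^T.
Let W := P *m M *m S.

(** All the data of [lyapunov_perturbation] are at most quadratic along a line of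
    controllers.  The first-order term, rewritten with transposes and cyclicity of
    the trace, exhibits the three partial gradients. *)
Lemma cost_directional_error : exists r c : F, 0 < r /\ forall h, `|h| < r ->
  `|cost_of (h *: dA + AK) (h *: dB + BK) (h *: dC + CK) - cost_of AK BK CK
    - h * (2 * (\tr (dA^T *m drsubmx W)
                + \tr (dB^T *m (dlsubmx W *m C^T + drsubmx P *m BK *m V))
                + \tr (dC^T *m (B^T *m ursubmx W + R *m CK *m drsubmx S))))|
    <= c * h ^+ 2.
Proof.
pose E := block_mx 0 (B *m dC) (dB *m C) dA.
pose Q1 : 'M[F]_(n + n) := block_mx 0 0 0 (dC^T *m R *m CK + CK^T *m R *m dC).
pose Q2 : 'M[F]_(n + n) := block_mx 0 0 0 (dC^T *m R *m dC).
pose X1 : 'M[F]_(n + n) := block_mx 0 0 0 (dB^T^T *m V *m BK^T + BK^T^T *m V *m dB^T).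
pose X2 : 'M[F]_(n + n) := block_mx 0 0 0 (dB^T^T *m V *m dB^T).
have psdXh h : sym_psd (pencil (cost_mx X11 V BK^T) X1 X2 h).
  by rewrite -cost_mx_pencil; apply: cost_mx_psd.
have [sP sS] : P^T = P /\ S^T = S.
  have [sP _] : sym_psd P.
    by apply: (lyapunov_psd (power_stable_tr stM) (cost_mx_psd psdQ pdR CK)); rewrite trmxK.
  by have [sS _] := lyapunov_psd stM (cost_mx_psd psdX pdV BK^T) SE.
have [r [c [r0 err]]] := lyapunov_perturbation E Q1 Q2 stM psdXh PE SE.
exists r, c; split=> // h /err[stMh].
have loopE : M + h *: E = loop_mx A B C (h *: dA + AK) (h *: dB + BK) (h *: dC + CK).
  rewrite /M /loop_mx scale_block_mx add_block_mx scaler0 addr0.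
  by congr block_mx; mx_expand; rewrite -?(scalemxAl, scalemxAr) addrC.
have [Sh ShE] := lyapunov_exists (pencil (cost_mx X11 V BK^T) X1 X2 h) stMh.
move=> /(_ Sh ShE); rewrite -cost_mx_pencil.
rewrite loopE in stMh ShE; rewrite -cost_mx_pencil in ShE.
rewrite /cost_of (cost_of_stable stM SE).
rewrite (cost_of_stable stMh (S := Sh)) /=; last first.
  by rewrite {1}ShE; mx_expand.
suff -> : \tr (P *m X1) + \tr ((Q1 + congr_derivative E M P) *m S) =
  2 * (\tr (dA^T *m drsubmx W)
       + \tr (dB^T *m (dlsubmx W *m C^T + drsubmx P *m BK *m V))
       + \tr (dC^T *m (B^T *m ursubmx W + R *m CK *m drsubmx S))) by [].
have [sV _] := pdV; have [sR _] := pdR.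
have trE : \tr (congr_derivative E M P *m S) = 2 * \tr (E^T *m W).
  rewrite mulmxDl mxtraceD mulr2n mulrDl mul1r.
  have -> : \tr (M^T *m P *m E *m S) = \tr (E^T *m W).
    rewrite -mxtrace_tr !trmx_mul trmxK sP sS mxtrace_mulC.
    by rewrite /W !mulmxA.
  by rewrite /W !mulmxA.
have corner (Z : 'M[F]_(n + n)) Y : \tr (block_mx 0 0 0 Y *m Z) = \tr (Y *m drsubmx Z).
  by rewrite -[Z in LHS]submxK mulmx_block mxtrace_block !mul0mx !addr0 mxtrace0 !add0r.
rewrite mulmxDl mxtraceD trE corner mxtrace_mulC corner !trmxK.
have sP22 : (drsubmx P)^T = drsubmx P by rewrite trmx_drsub sP.
have sS22 : (drsubmx S)^T = drsubmx S by rewrite trmx_drsub sS.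
have -> : \tr (E^T *m W) = \tr (dA^T *m drsubmx W) + \tr (dB^T *m (dlsubmx W *m C^T))
    + \tr (dC^T *m (B^T *m ursubmx W)).
  rewrite -[W in LHS]submxK tr_block_mx mulmx_block mxtrace_block !trmx_mul trmx0.
  rewrite !mul0mx add0r !mxtraceD -mulmxA mxtrace_mulC !mulmxA.
  by rewrite addrA addrC addrA.
have -> : \tr ((dB *m V *m BK^T + BK *m V *m dB^T) *m drsubmx P) =
    2 * \tr (dB^T *m (drsubmx P *m BK *m V)).
  rewrite mulmxDl mxtraceD mulr2n mulrDl mul1r; congr (_ + _).
    by rewrite -mxtrace_tr !trmx_mul trmxK sV sP22 !mulmxA mxtrace_mulC !mulmxA.
  by rewrite mxtrace_mulC !mulmxA mxtrace_mulC !mulmxA.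
have -> : \tr ((dC^T *m R *m CK + CK^T *m R *m dC) *m drsubmx S) =
    2 * \tr (dC^T *m (R *m CK *m drsubmx S)).
  rewrite mulmxDl mxtraceD mulr2n mulrDl mul1r; congr (_ + _); first by rewrite !mulmxA.
  by rewrite -[LHS]mxtrace_tr !trmx_mul trmxK sR sS22 mxtrace_mulC !mulmxA.
by rewrite [dB^T *m (_ + _)]mulmxDr [dC^T *m (_ + _)]mulmxDr !mxtraceD; ring.
Qed.

End Direction.

Lemma mxtrace_delta p q (i : 'I_p) (j : 'I_q) (Z : 'M[F]_(p, q)) :
  \tr ((delta_mx i j)^T *m Z) = Z i j.
Proof.
rewrite trmx_delta -(mul_delta_mx (0 : 'I_1)) -mulmxA mxtrace_mulC -rowE -colE.
by rewrite trace_mx11 !mxE.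
Qed.

Lemma stationary_equations K P S : let M := closed_loop_mx A B C K in
  power_stable M -> stationary A B C Q R x0 s K ->
  P = cost_mx Q R (ctrlC K) + M^T *m P *m M ->
  S = cost_mx X11 V (ctrlB K)^T + M *m S *m M^T ->
  [/\ drsubmx (P *m M *m S) = 0,
      dlsubmx (P *m M *m S) *m C^T + drsubmx P *m ctrlB K *m V = 0 &
      B^T *m ursubmx (P *m M *m S) + R *m ctrlC K *m drsubmx S = 0].
Proof.
move=> M stM [[_ gA] [_ gB] [_ gC]] PE SE.
have err dA dB dC := cost_directional_error dA dB dC stM PE SE.
have zero p q (f : 'M[F]_(p, q) -> F^o) X (G : 'M[F]_(p, q)) :
    gradient f X = 0 ->
    (forall D, exists r c : F, 0 < r /\ forall h, `|h| < r ->
      `|f (h *: D + X) - f X - h * (2 * \tr (D^T *m G))| <= c * h ^+ 2) -> G = 0.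
  move=> g0 errD; apply/matrixP => i j; rewrite mxE.
  have [r [c [r0 /(derive_of_quadratic_error r0)]]] := errD (delta_mx i j).
  have := congr1 (fun Z : 'M[F]_(p, q) => Z i j) g0; rewrite !mxE => -> /esym/eqP.
  by rewrite mxtrace_delta mulf_eq0 pnatr_eq0 /= => /eqP.
split.
- apply: zero gA _ => D; have [r [c [r0 rP]]] := err D 0 0; exists r, c; split=> // h /rP.
  by rewrite !scaler0 !add0r !trmx0 !mul0mx !mxtrace0 !addr0.
- apply: zero gB _ => D; have [r [c [r0 rP]]] := err 0 D 0; exists r, c; split=> // h /rP.
  by rewrite !scaler0 !add0r !trmx0 !mul0mx !mxtrace0 !addr0 !add0r.
- apply: zero gC _ => D; have [r [c [r0 rP]]] := err 0 0 D; exists r, c; split=> // h /rP.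
  by rewrite !scaler0 !add0r !trmx0 !mul0mx !mxtrace0 !add0r.
Qed.

End GradientEquations.

(** * Rank conditions *)

Section KalmanRank.
Variable F : realType.

Lemma observable_vec n q (C : 'M[F]_(q, n)) (A : 'M[F]_n) (v : 'cV[F]_n) :
  observable C A -> (forall k, (k < n)%N -> C *m (A ^+ k *m v) = 0) -> v = 0.
Proof.
move=> obs Cv0; have /row_fullP[D DE] : row_full (observability_mx C A).
  by rewrite /row_full obs.
rewrite -[v]mul1mx -DE -mulmxA mxcol_mul.
rewrite (_ : \mxcol_i _ = 0) ?mulmx0 //.
by rewrite -[RHS]mxcol0; apply/eq_mxcolP => k; rewrite -mulmxA Cv0.
Qed.

Lemma observability_tr n p (A : 'M[F]_n) (B : 'M[F]_(n, p)) :
  observability_mx B^T A^T = (reachability_mx A B)^T.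
Proof.
by rewrite /observability_mx tr_mxrow; apply/eq_mxcolP => k; rewrite trmx_mul trmxX.
Qed.

Lemma reachable_tr n p (A : 'M[F]_n) (B : 'M[F]_(n, p)) :
  reachable A B <-> observable B^T A^T.
Proof. by rewrite /observable observability_tr mxrank_tr. Qed.

(** The [D k] are the blocks of a right inverse of the reachability matrix. *)
Lemma reachable_steering n p (A : 'M[F]_n) (B : 'M[F]_(n, p)) :
  reachable A B -> exists D : nat -> 'M[F]_(p, n), \sum_(k < n) A ^+ k *m B *m D k = 1%:M.
Proof.
move=> rch; have /row_freeP[D DE] : row_free (reachability_mx A B).
  by rewrite /row_free rch.
exists (fun k => if insub k is Some i then submxcol D i else 0).
rewrite -DE -[D in RHS]submxcolK mul_mxrow_mxcol; apply: eq_bigr => i _.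
by rewrite valK.
Qed.

Lemma psd_sqrt_sym n (M : 'M[F]_n) : (psd_sqrt M)^T = psd_sqrt M.
Proof.
by rewrite /psd_sqrt; case: xgetP => [S _ [[]]|_]; rewrite ?trmx0.
Qed.

(** True both of a genuine square root and of the default value 0. *)
Lemma psd_sqrt_ker n (M : 'M[F]_n) v : quad_form M v = 0 -> psd_sqrt M *m v = 0.
Proof.
rewrite /psd_sqrt; case: xgetP => [S _ [[sS _] <-]|_ _]; last by rewrite mul0mx.
by rewrite -{1}sS -[S^T]mulmx1 quad_form_congr => /sqnorm_eq0.
Qed.

Lemma observable_sqrt_vec n (A Q : 'M[F]_n) (v : 'cV[F]_n) : observable (psd_sqrt Q) A ->
  (forall k, (k < n)%N -> quad_form Q (A ^+ k *m v) = 0) -> v = 0.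
Proof. by move=> /observable_vec ob Qv; apply: ob => k /Qv /psd_sqrt_ker. Qed.

End KalmanRank.

(** * Changes of controller coordinates *)

Section Similarity.
Variable F : realType.

Lemma differentiable_mulmx2 p q p' q' (U : 'M[F]_(p', p)) (W : 'M[F]_(q, q')) X :
  differentiable (fun Y : 'M[F]_(p, q) => U *m Y *m W) X.
Proof.
have -> : (fun Y : 'M[F]_(p, q) => U *m Y *m W) =
    \sum_(i < p) \sum_(j < q) (fun Y : 'M[F]_(p, q) => Y i j *: (U *m delta_mx i j *m W)).
  apply/funext => Y; rewrite fct_sumE {1}(matrix_sum_delta Y) mulmx_sumr mulmx_suml.
  apply: eq_bigr => i _; rewrite fct_sumE mulmx_sumr mulmx_suml.
  by apply: eq_bigr => j _; rewrite -scalemxAr -scalemxAl.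
apply: differentiable_sum => i; apply: differentiable_sum => j.
exact/differentiableZl/differentiable_coord.
Qed.

(** A change of coordinates acts on each block of the controller by a map of this
    form. *)
Lemma gradient_vanishes_mulmx2 p q p' q' (f : 'M[F]_(p', q') -> F^o)
    (U : 'M[F]_(p', p)) (W : 'M[F]_(q, q')) X :
  gradient_vanishes f (U *m X *m W) ->
  gradient_vanishes (fun Y => f (U *m Y *m W)) X.
Proof.
move=> [df g0]; split.
  by apply: (differentiable_comp (differentiable_mulmx2 U W X)).
have D0 w : 'D_w f (U *m X *m W) = 0.
  rewrite deriveE // (matrix_sum_delta w) linear_sum big1 // => i _.
  rewrite linear_sum big1 // => j _; rewrite linearZ /= -deriveE //.
  by have /matrixP /(_ i j) := g0; rewrite !mxE => ->; rewrite scaler0.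
apply/matrixP => i j; rewrite !mxE -(D0 (U *m delta_mx i j *m W)) /derive.
have -> : (fun h => h^-1 *: (((fun Y => f (U *m Y *m W)) \o shift X)
      (h *: delta_mx i j) - f (U *m X *m W))) =
    (fun h => h^-1 *: ((f \o shift (U *m X *m W)) (h *: (U *m delta_mx i j *m W))
      - f (U *m X *m W))) => //.
by apply/funext => h /=; rewrite mulmxDr mulmxDl -scalemxAr -scalemxAl.
Qed.

Lemma invmx_eq n (T U : 'M[F]_n) : T *m U = 1%:M -> U = invmx T.
Proof.
by move=> TU; have [uT _] := mulmx1_unit TU; rewrite -[LHS](mulKmx uT) TU mulmx1.
Qed.

Lemma conj_exp n (T A : 'M[F]_n) k : T \in unitmx ->
  (T *m A *m invmx T) ^+ k = T *m A ^+ k *m invmx T.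
Proof.
move=> uT; elim: k => [|k IHk]; first by rewrite !expr0 mulmx1 mulmxV.
by rewrite !mulmxXS IHk !mulmxA mulmxKV.
Qed.

Lemma observable_conj n q (T A : 'M[F]_n) (C : 'M[F]_(q, n)) : T \in unitmx ->
  observable C A -> observable (C *m invmx T) (T *m A *m invmx T).
Proof.
move=> uT obs; rewrite /observable -[RHS]obs.
have -> : observability_mx (C *m invmx T) (T *m A *m invmx T) =
    observability_mx C A *m invmx T.
  rewrite /observability_mx mxcol_mul; apply/eq_mxcolP => k.
  by rewrite conj_exp // !mulmxA mulmxKV.
by rewrite mxrankMfree // row_free_unit unitmx_inv.
Qed.

Lemma reachable_conj n q (T A : 'M[F]_n) (B : 'M[F]_(n, q)) : T \in unitmx ->
  reachable A B -> reachable (T *m A *m invmx T) (T *m B).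
Proof.
move=> uT /reachable_tr; have uT' : (invmx T)^T \in unitmx by rewrite unitmx_tr unitmx_inv.
move=> /(observable_conj uT') obs; apply/reachable_tr.
by move: obs; rewrite !trmx_mul -trmx_inv invmxK !mulmxA.
Qed.

Context {dO : measure_display} {Omega : measurableType dO}.
Variable Pr : probability Omega F.
Variables (n m d : nat).
Variables (A : 'M[F]_n) (B : 'M[F]_(n, m)) (C : 'M[F]_(d, n)).
Variables (Q : 'M[F]_n) (R : 'M[F]_m).
Variables (x0 : 'I_n -> {RV Pr >-> F}) (s : 'I_d -> {RV Pr >-> F}).
Implicit Types (K : 'M[F]_(m + n, d + n)) (T : 'M[F]_n).

Lemma trajectory_sim T K x z t : T \in unitmx ->
  trajectory A B C (sim_transform T K) x z t =
  ((trajectory A B C K x z t).1, T *m (trajectory A B C K x z t).2).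
Proof.
move=> uT; have [eA eB eC] := ctrl_mxK (T *m ctrlA K *m invmx T) (T *m ctrlB K)
  (ctrlC K *m invmx T).
elim: t => [|t IHt] /=; first by rewrite /sim_transform eB mulmxA.
rewrite IHt; case: (trajectory A B C K x z t) => y xi /=.
by rewrite /sim_transform eA eB eC !mulmxA !mulmxKV // mulmxDr !mulmxA.
Qed.

Lemma cost_sim T K : T \in unitmx ->
  cost A B C Q R x0 s (sim_transform T K) = cost A B C Q R x0 s K.
Proof.
move=> uT; have [eA eB eC] := ctrl_mxK (T *m ctrlA K *m invmx T) (T *m ctrlB K)
  (ctrlC K *m invmx T).
apply: eq_integral => w _; apply: eq_eseriesr => t _; congr EFin.
rewrite /stage_cost trajectory_sim //; case: (trajectory A B C K _ _ t) => y xi /=.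
by rewrite /sim_transform eC mulmxA mulmxKV.
Qed.

Lemma stabilizing_sim T K : T \in unitmx -> stabilizing A B C K ->
  stabilizing A B C (sim_transform T K).
Proof.
move=> uT [_ srK]; split; first by rewrite /sim_transform /ctrl_mx block_mxKul.
pose D : 'M[F]_(n + n) := block_mx 1%:M 0 0 T.
have DV : D *m block_mx 1%:M 0 0 (invmx T) = 1%:M.
  by rewrite mulmx_block ?(mulmx1, mul1mx, mulmx0, mul0mx, addr0, add0r) mulmxV // -scalar_mx_block.
have [uD _] := mulmx1_unit DV.
suff -> : closed_loop_mx A B C (sim_transform T K) = D *m closed_loop_mx A B C K *m invmx D.
  by rewrite spectral_radius_conj.
rewrite -(invmx_eq DV) /sim_transform closed_loop_ctrl_mx /loop_mx /closed_loop_mx.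
by rewrite !mulmx_block ?(mulmx1, mul1mx, mulmx0, mul0mx, addr0, add0r) !mulmxA.
Qed.

Lemma minimal_sim T K : T \in unitmx -> @minimal F n m d K -> minimal (sim_transform T K).
Proof.
move=> uT [obs rch]; rewrite /minimal /=.
have [-> -> ->] := ctrl_mxK (T *m ctrlA K *m invmx T) (T *m ctrlB K) (ctrlC K *m invmx T).
by split; [apply: observable_conj|apply: reachable_conj].
Qed.

(** As the cost is invariant, each partial cost at the transformed controller is
    the one at [K] composed with a linear map. *)
Lemma stationary_sim T K : T \in unitmx -> stationary A B C Q R x0 s K ->
  stationary A B C Q R x0 s (sim_transform T K).
Proof.
move=> uT [gA gB gC]; rewrite /stationary /=.
have [-> -> ->] := ctrl_mxK (T *m ctrlA K *m invmx T) (T *m ctrlB K) (ctrlC K *m invmx T).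
have simE AK BK CK : sim_transform T (ctrl_mx AK BK CK) =
    ctrl_mx (T *m AK *m invmx T) (T *m BK) (CK *m invmx T).
  by rewrite /sim_transform; have [-> -> ->] := ctrl_mxK AK BK CK.
pose fA AK : F^o := fine (cost A B C Q R x0 s (ctrl_mx AK (ctrlB K) (ctrlC K))).
pose fB BK : F^o := fine (cost A B C Q R x0 s (ctrl_mx (ctrlA K) BK (ctrlC K))).
pose fC CK : F^o := fine (cost A B C Q R x0 s (ctrl_mx (ctrlA K) (ctrlB K) CK)).
split.
- rewrite (_ : (fun _ => _) = fun Y => fA (invmx T *m Y *m T)).
    apply: (gradient_vanishes_mulmx2 (f := fA)).
    have -> : invmx T *m (T *m ctrlA K *m invmx T) *m T = ctrlA K.
      by rewrite -!mulmxA mulVmx // mulmx1 mulKmx.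
    exact: gA.
  apply/funext => Y; rewrite /fA -(cost_sim (ctrl_mx (invmx T *m Y *m T) _ _) uT) simE.
  rewrite (_ : T *m (invmx T *m Y *m T) *m invmx T = Y); first exact: erefl.
  by rewrite !mulmxA mulmxV // mul1mx mulmxK.
- rewrite (_ : (fun _ => _) = fun Y => fB (invmx T *m Y *m 1%:M)).
    apply: (gradient_vanishes_mulmx2 (f := fB)).
    have -> : invmx T *m (T *m ctrlB K) *m 1%:M = ctrlB K by rewrite mulmx1 mulKmx.
    exact: gB.
  apply/funext => Y; rewrite /fB -(cost_sim (ctrl_mx _ (invmx T *m Y *m 1%:M) _) uT) simE.
  rewrite (_ : T *m (invmx T *m Y *m 1%:M) = Y); first exact: erefl.
  by rewrite mulmx1 mulKVmx.
- rewrite (_ : (fun _ => _) = fun Y => fC (1%:M *m Y *m T)).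
    apply: (gradient_vanishes_mulmx2 (f := fC)).
    have -> : 1%:M *m (ctrlC K *m invmx T) *m T = ctrlC K by rewrite mul1mx mulmxKV.
    exact: gC.
  apply/funext => Y; rewrite /fC -(cost_sim (ctrl_mx _ _ (1%:M *m Y *m T)) uT) simE.
  rewrite (_ : 1%:M *m Y *m T *m invmx T = Y); first exact: erefl.
  by rewrite mul1mx mulmxK.
Qed.

Lemma sim_transform_quotient T U K : T \in unitmx -> U \in unitmx ->
  sim_transform T K = sim_transform (T *m invmx U) (sim_transform U K).
Proof.
move=> uT uU; rewrite {2}/sim_transform {1}/sim_transform.
have -> : invmx (T *m invmx U) = U *m invmx T.
  by apply/esym/invmx_eq; rewrite mulmxA mulmxKV // mulmxV.
rewrite /sim_transform.
have [-> -> ->] := ctrl_mxK (U *m ctrlA K *m invmx U) (U *m ctrlB K) (ctrlC K *m invmx U).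
by rewrite !mulmxA !mulmxKV.
Qed.

End Similarity.

(** * Minimal stationary points *)

Section MinimalStationaryPoints.
Context {dO : measure_display} {Omega : measurableType dO} {F : realType}.
Variable Pr : probability Omega F.
Variables (n m d : nat).
Variables (A : 'M[F]_n) (B : 'M[F]_(n, m)) (C : 'M[F]_(d, n)).
Variables (Q : 'M[F]_n) (R : 'M[F]_m).
Variables (x0 : 'I_n -> {RV Pr >-> F}) (s : 'I_d -> {RV Pr >-> F}).
Hypotheses (psdQ : sym_psd Q) (pdR : sym_pd R).
Hypotheses (L2x0 : square_integrable x0) (L2s : square_integrable s).
Hypotheses (Es0 : zero_mean s) (indep : independent x0 s).
Let X11 := second_moment x0.
Let V := second_moment s.
Hypotheses (psdX : sym_psd X11) (pdV : sym_pd V).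

Lemma minimal_stationary_structure K :
  stabilizing A B C K -> @minimal F n m d K -> stationary A B C Q R x0 s K ->
  exists Ph Sh T : 'M[F]_n,
  [/\ sym_psd Ph /\ Ph = riccati_map A B Q R Ph,
      sym_psd Sh /\ Sh = riccati_map A^T C^T X11 V Sh, T \in unitmx,
      K = sim_transform T (observer_ctrl A B C (ctrl_gain A B R Ph) (filter_gain A C V Sh)) &
      cost A B C Q R x0 s K = (optimal_cost A B X11 R Ph Sh)%:E].
Proof.
move=> [K0 srK] [obsK rchK] statK; pose M := closed_loop_mx A B C K.
have stM : power_stable M := spectral_radius_power_stable srK.
have [P PE] : exists P, P = cost_mx Q R (ctrlC K) + M^T *m P *m M.
  by have := lyapunov_exists (cost_mx Q R (ctrlC K)) (power_stable_tr stM); rewrite trmxK.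
have [S SE] := lyapunov_exists (cost_mx X11 V (ctrlB K)^T) stM.
have psdP : sym_psd P.
  by apply: (lyapunov_psd (power_stable_tr stM) (cost_mx_psd psdQ pdR (ctrlC K)));
    rewrite trmxK.
have psdS := lyapunov_psd stM (cost_mx_psd psdX pdV (ctrlB K)^T) SE.
have [gA gB gC] := stationary_equations psdQ pdR L2x0 L2s Es0 indep psdX pdV stM statK PE SE.
have pdP22 : sym_pd (drsubmx P).
  apply: (controller_gramian_pd psdQ pdR psdP PE) => v Cv.
  by apply: (observable_vec obsK) => k _.
have pdS22 : sym_pd (drsubmx S).
  have SE' : S = cost_mx X11 V (ctrlB K)^T
      + (loop_mx A^T C^T B^T (ctrlA K)^T (ctrlC K)^T (ctrlB K)^T)^T *m S
        *m loop_mx A^T C^T B^T (ctrlA K)^T (ctrlC K)^T (ctrlB K)^T.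
    by rewrite -tr_loop_mx trmxK.
  apply: (controller_gramian_pd psdX pdV psdS SE') => v Bv.
  by apply: (observable_vec (iffLR (reachable_tr _ _) rchK)) => k _.
have [Ph [Sh [T [psdPh PhE psdSh ShE [uT BE CE AE ShS]]]]] :=
  stationary_structure pdR pdV PE SE psdP psdS pdP22 pdS22 gA gB gC.
exists Ph, Sh, T; split=> //.
  rewrite /observer_ctrl /sim_transform.
  have [-> -> ->] := ctrl_mxK (A - B *m ctrl_gain A B R Ph - filter_gain A C V Sh *m C)
    (filter_gain A C V Sh) (- ctrl_gain A B R Ph).
  by rewrite -AE -BE -CE -[LHS]submxK K0.
rewrite (cost_stable psdQ pdR L2x0 L2s Es0 indep stM SE); congr EFin.
exact: (optimal_cost_attained pdR psdPh PhE SE CE ShS).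
Qed.

Lemma optimal_cost_lower_bound Ph Sh K :
  sym_psd Ph -> Ph = riccati_map A B Q R Ph ->
  sym_psd Sh -> Sh = riccati_map A^T C^T X11 V Sh ->
  stabilizing A B C K ->
  ((optimal_cost A B X11 R Ph Sh)%:E <= cost A B C Q R x0 s K)%E.
Proof.
move=> psdPh PhE psdSh ShE [K0 srK].
have stM := spectral_radius_power_stable srK.
have [S SE] := lyapunov_exists (cost_mx X11 V (ctrlB K)^T) stM.
rewrite (cost_stable psdQ pdR L2x0 L2s Es0 indep stM SE) lee_fin.
exact: (optimal_cost_le pdR pdV psdPh PhE psdSh ShE stM SE).
Qed.

End MinimalStationaryPoints.

Lemma riccati_solution_exists (F : realType) n m (A : 'M[F]_n) (B : 'M[F]_(n, m)) Q R :
  sym_psd Q -> sym_pd R -> controllable A B -> observable (psd_sqrt Q) A ->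
  exists P, unique (pd_ctrl_riccati A B Q R) P.
Proof.
move=> psdQ pdR /reachable_steering[D DE] obsQ.
have obs v := @observable_sqrt_vec F n A Q v obsQ.
have [P [psdP PE]] := riccati_exists psdQ pdR DE.
exists P; split=> [|P' [pdP' P'E]]; first by split=> //; apply: riccati_psd_pd PE.
exact: (riccati_unique psdQ pdR obs psdP (sym_pd_psd pdP') PE P'E).
Qed.

Lemma pd_filter_riccati_dual (F : realType) n d (A : 'M[F]_n) (C : 'M[F]_(d, n)) X11 V S :
  pd_filter_riccati A C X11 V S <-> pd_ctrl_riccati A^T C^T X11 V S.
Proof. by rewrite /pd_filter_riccati /pd_ctrl_riccati !trmxK [V + _]addrC. Qed.

Theorem theorem2 (F : realType) (n m d : nat)
    (A : 'M[F]_n) (B : 'M[F]_(n, m)) (C : 'M[F]_(d, n))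
    (Q : 'M[F]_n) (R : 'M[F]_m)
    (dO : measure_display) (Omega : measurableType dO)
    (P : probability Omega F)
    (x0 : 'I_n -> {RV P >-> F}) (s : 'I_d -> {RV P >-> F})
    (X11 : 'M[F]_n) (V : 'M[F]_d)
    (hQ : sym_psd Q) (hR : sym_pd R)
    (hx0 : square_integrable x0) (hs : square_integrable s)
    (hs0 : zero_mean s) (hind : independent x0 s)
    (hX11 : X11 = second_moment x0) (hVs : V = second_moment s)
    (hC : row_free C)
    (hAX : reachable A (psd_sqrt X11))
    (hV : sym_pd V)
    (hAB : controllable A B)
    (hCA : observable C A)
    (hQA : observable (psd_sqrt Q) A) :
  let min_stat : set 'M[F]_(m + n, d + n) :=
    stabilizing A B C `&` @minimal F n m d `&` stationary A B C Q R x0 s in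
  (forall K, min_stat K -> globally_optimal A B C Q R x0 s K) /\
  exists Phat Sigmahat : 'M[F]_n,
    [/\ unique (pd_ctrl_riccati A B Q R) Phat,
        unique (pd_filter_riccati A C X11 V) Sigmahat &
        let Kdd := observer_ctrl A B C (ctrl_gain A B R Phat)
                     (filter_gain A C V Sigmahat) in
        (exists K, min_stat K) ->
        min_stat = [set sim_transform T Kdd | T in [set T | T \in unitmx]]].
Proof.
move=> min_stat; subst X11 V.
have psdX := second_moment_psd hx0.
have obsX : observable (psd_sqrt (second_moment x0)) A^T.
  by move/reachable_tr: hAX; rewrite psd_sqrt_sym.
have ctrlC : controllable A^T C^T by apply/reachable_tr; rewrite !trmxK.
have struct K : min_stat K -> _ := fun mK =>
  minimal_stationary_structure hQ hR hx0 hs hs0 hind psdX hV mK.1.1 mK.1.2 mK.2.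
split=> [K mK|].
  split; first exact: mK.1.1.
  have [Ph [Sh [T [[psdPh PhE] [psdSh ShE] _ _ ->]]]] := struct K mK.
  move=> K' stK'; exact: optimal_cost_lower_bound.
have [Phat uP] := riccati_solution_exists hQ hR hAB hQA.
have [Shat uS] := riccati_solution_exists psdX hV ctrlC obsX.
exists Phat, Shat; split=> //.
  by split=> [|S /pd_filter_riccati_dual]; [apply/pd_filter_riccati_dual; case: uS|case: uS => _; apply].
move=> Kdd [K1 mK1].
have form K : min_stat K -> exists2 T, T \in unitmx & K = sim_transform T Kdd.
  move=> /struct[Ph [Sh [T [[psdPh PhE] [psdSh ShE] uT KE _]]]]; exists T; first exact: uT.
  have pdPh := riccati_psd_pd hQ hR (fun v => observable_sqrt_vec hQA) psdPh PhE.
  have pdSh := riccati_psd_pd psdX hV (fun v => observable_sqrt_vec obsX) psdSh ShE.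
  rewrite /Kdd (uP.2 Ph) ?(uS.2 Sh) //; split=> //.
have [T1 uT1 K1E] := form K1 mK1.
apply/seteqP; split=> [K /form[T uT ->]|_ [T uT <-]]; first by exists T.
rewrite (sim_transform_quotient Kdd uT uT1) -K1E.
have uTT : T *m invmx T1 \in unitmx by rewrite unitmx_mul unitmx_inv; apply/andP.
have [[stK1 minK1] statK1] := mK1.
by split; [split; [apply: stabilizing_sim|apply: minimal_sim]|apply: stationary_sim].
Qed.
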